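(* Let $(T,\Phi)$ be a weighted generalized triangulation of a closed connected surface $X$, with vertex set $V=\{v_1,\dots,v_N\}$. For any initial circle-packing metric in $\mathbf{R}_{>0}^N$ based on $(T,\Phi)$ in Euclidean background geometry, the solution of the normalized combinatorial Ricci flow $$\frac{dr_i}{dt}=-(K_i-K_{av})\,r_i,\qquad i=1,\dots,N,$$ with this initial value converges if and only if for every nonempty proper subset $I\subset V$, $$\frac{2\pi\chi(X)|I|}{N}>-\sum_{(e,v)\in Lk(I)}(\pi-\Phi(e))+2\pi\chi(F_I).$$ Furthermore, if the solution converges, it converges exponentially fast to the metric of constant curvature $2\pi\chi(X)/N$ (i.e. $K_i(\infty)=2\pi\chi(X)/N$ for all $i$).
   Context: A generalized triangulation $T$ of a surface $X$ is a cell-division of $X$ into vertices, edges and triangles (sets $V=\{v_1,\dots,v_N\}$, $E$, $F$) whose lift to the universal cover is a triangulation. In particular each triangle lifts to an embedding in the universal cover, and there are no vertices of degree 1 or 2. Also there are no null homotopic loops formed by at most 2 edges. Furthermore, given three vertices, there is at most one triangle having them as vertices. A weight is a function $\Phi:E\to[0,\pi/2]$; $(T,\Phi)$ is then called a weighted generalized triangulation. Circle-packing metric (Euclidean background). A circle-packing metric based on $(T,\Phi)$ is a vector $r=(r_1,\dots,r_N)\in\mathbf{R}_{>0}^N$ ($r_i$ is assigned to $v_i$). An edge $e$ joining $v_i$ and $v_j$ is given length $\sqrt{r_i^2+r_j^2+2r_ir_j\cos\Phi(e)}$. Because $\Phi\le\pi/2$, each triangle of $T$ can be realized as a Euclidean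 triangle with these edge lengths. Let $a_i$ be the sum of all inner angles having vertex $v_i$ in triangles of $T$; the curvature at $v_i$ is $K_i=2\pi-a_i$, and $K_{av}=\frac1N\sum_{i=1}^N K_i$ (which equals $2\pi\chi(X)/N$). Convergence. A solution $r(t)$, $t\ge0$, is called convergent if $\lim_{t\to\infty}K_i(t)=K_i(\infty)\in(-\infty,2\pi)$ and $\lim_{t\to\infty}r_i(t)=r_i(\infty)\in\mathbf{R}_{>0}$ exist for all $i$. A convergent solution converges exponentially fast if there are positive constants $c_1,c_2$ with $|K_i(t)-K_i(\infty)|\le c_1e^{-c_2t}$ and $|r_i(t)-r_i(\infty)|\le c_1e^{-c_2t}$ for all $t\ge0$ and all $i$. For $I\subset V$, $F_I$ is the subcomplex of $T$ consisting of all cells whose vertices are in $I$, $\chi$ denotes Euler characteristic, $|I|$ is the number of elements of $I$, and $Lk(I)$ is the set of pairs $(e,v)$ of an edge $e$ and a vertex $v$ such that the end points of $e$ are not in $I$, the vertex $v$ is in $I$, and $e$ and $v$ form a triangle of $T$. *)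

(* Defs.v *)
From mathcomp Require Import all_boot all_order all_algebra.

Set Implicit Arguments.
Unset Strict Implicit.
Unset Printing Implicit Defensive.

Import Order.TTheory GRing.Theory Num.Theory.
Local Open Scope ring_scope.

(* A cell division of a closed connected surface is encoded by its flags      *)
(* (incident triples vertex-edge-triangle, i.e. the triangles of the          *)
(* barycentric subdivision).  A flag has exactly one neighbour across each of *)
(* its three sides: flip 0, flip 1, flip 2 changes only the vertex, the edge, *)
(* the triangle respectively.  This presents orientable and nonorientable     *)
(* surfaces alike, and allows loops, multiple edges, and a triangle glued to  *)
(* itself.                                                                    *)
Definition walk (D : Type) (flip : 'I_3 -> D -> D) (x : D) (w : seq 'I_3) : D :=
  foldl (fun y k => flip k y) x w.

Record cell_division := CellDivision {
  vertex : finType;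
  edge : finType;
  triangle : finType;
  flag : finType;
  vtx : flag -> vertex;
  edg : flag -> edge;
  tri : flag -> triangle;
  flip : 'I_3 -> flag -> flag;
  flipK : forall k, involutive (flip k);
  (* no boundary *)
  flip_neq : forall k x, flip k x != x;
  flag_nonempty : (0 < #|flag|)%N;
  flag_connected : forall x y, exists w, walk flip x w = y;
  (* the flags around a cell form a single cycle *)
  vtxP : forall x y, vtx x = vtx y <-> exists2 w, 0 \notin w & walk flip x w = y;
  edgP : forall x y, edg x = edg y <-> exists2 w, 1 \notin w & walk flip x w = y;
  triP : forall x y, tri x = tri y <-> exists2 w, 2 \notin w & walk flip x w = y;
  vtx_surj : forall v, exists x, vtx x = v;
  (* an edge has two ends and two sides; a triangle has three corners, each   *)
  (* lying on two of its sides                                                *)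
  card_edg : forall e, #|[set x | edg x == e]| = 4%N;
  card_tri : forall t, #|[set x | tri x == t]| = 6%N
}.

Section Combinatorics.
Variable T : cell_division.
Implicit Types (x y : flag T) (w p c q : seq 'I_3) (I : {set vertex T}).

(* A word w is the path of flags starting at x that crosses the sides w_0,    *)
(* w_1, and so on.  A closed subpath c that never uses the side k stays in    *)
(* the star of one barycentre, which is a disc, and can be contracted; these  *)
(* contractions generate the homotopies with fixed ends.  Hence the flags of  *)
(* the universal cover based at x are the words up to homotopic x.            *)
Inductive homotopic x : seq 'I_3 -> seq 'I_3 -> Prop :=
| homotopic_refl w : homotopic x w w
| homotopic_sym w w' : homotopic x w w' -> homotopic x w' w
| homotopic_trans w w' w'' :
    homotopic x w w' -> homotopic x w' w'' -> homotopic x w w''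
| homotopic_contract (k : 'I_3) p c q :
    k \notin c -> walk (@flip T) (walk (@flip T) x p) c = walk (@flip T) x p ->
    homotopic x (p ++ c ++ q) (p ++ q).

(* The flags w and w' of the universal cover have the same vertex (k = 0),    *)
(* edge (k = 1), triangle (k = 2) in the universal cover.                     *)
Definition same_lifted_cell x (k : 'I_3) w w' :=
  exists2 u, k \notin u & homotopic x (w ++ u) w'.

(* The lifted cell division is a simplicial complex: the two ends of an edge  *)
(* are distinct, and edges and triangles are determined by their vertices.    *)
(* The vertices of the triangle of a flag y are those of the flags y, flip 0  *)
(* y and flip 0 (flip 1 y).                                                   *)
Definition generalized_triangulation : Prop :=
  [/\ forall x w, ~ same_lifted_cell x 0 w (w ++ [:: 0]),
      forall x w w',
        same_lifted_cell x 0 w w' ->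
        same_lifted_cell x 0 (w ++ [:: 0]) (w' ++ [:: 0]) ->
        same_lifted_cell x 1 w w'
    & forall x w w',
        same_lifted_cell x 0 w w' ->
        same_lifted_cell x 0 (w ++ [:: 0]) (w' ++ [:: 0]) ->
        same_lifted_cell x 0 (w ++ [:: 1; 0]) (w' ++ [:: 1; 0]) ->
        same_lifted_cell x 2 w w'].

Definition edge_vertices (e : edge T) : {set vertex T} :=
  [set vtx x | x : flag T & edg x == e].

Definition triangle_vertices (t : triangle T) : {set vertex T} :=
  [set vtx x | x : flag T & tri x == t].

(* chi(F_I), where F_I consists of the cells with all vertices in I *)
Definition euler_sub I : int :=
  #|I|%:Z - #|[set e | edge_vertices e \subset I]|%:Z
          + #|[set t | triangle_vertices t \subset I]|%:Z.

(* chi(X) *)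
Definition euler : int :=
  #|vertex T|%:Z - #|edge T|%:Z + #|triangle T|%:Z.

(* a flag, in the same triangle, of the edge opposite to the corner of x *)
Definition opp x : flag T := flip 1 (flip 0 x).

(* Only in the universal cover are triangles determined by their vertices: in *)
(* T itself an edge e and a vertex v may form two triangles, each of which    *)
(* contributes to the sum over Lk(I) (e.g. the square torus with an added     *)
(* vertex at the centre of the square).  So a pair (e, v) is recorded with    *)
(* the triangle it forms; when triangles are determined by their vertices in  *)
(* T, that component is redundant and Lk I is just the set of pairs (e, v).   *)
Definition Lk I : {set edge T * vertex T * triangle T} :=
  [set (edg (opp x), vtx x, tri x) | x : flag T
     & (vtx x \in I) && [disjoint edge_vertices (edg (opp x)) & I]].

End Combinatorics.

From mathcomp Require Import all_classical all_reals all_analysis.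
Import numFieldNormedType.Exports.
Local Open Scope classical_set_scope.
Local Open Scope ring_scope.

Section Flow.
Variables (R : realType) (T : cell_division) (Phi : edge T -> R).
Implicit Types (x : flag T) (i : vertex T) (r : vertex T -> R).

Definition edge_length r x : R :=
  let a := r (vtx x) in let b := r (vtx (flip 0 x)) in
  Num.sqrt (a ^+ 2 + b ^+ 2 + 2 * a * b * cos (Phi (edg x))).

(* inner angle at the corner of x, by the law of cosines *)
Definition inner_angle r x : R :=
  let b := edge_length r x in
  let c := edge_length r (flip 1 x) in
  let a := edge_length r (opp x) in
  acos ((b ^+ 2 + c ^+ 2 - a ^+ 2) / (2 * b * c)).

(* each corner belongs to exactly two flags, x and flip 1 x *)
Definition cone_angle r i : R := (\sum_(x | vtx x == i) inner_angle r x) / 2.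

Definition curvature r i : R := 2 * pi - cone_angle r i.

Definition curvature_avg r : R := (\sum_i curvature r i) / #|vertex T|%:R.

(* At t = 0 continuity is required; the right-hand side being continuous, the *)
(* one-sided equation at t = 0 follows.                                       *)
Definition ricci_flow (r0 : vertex T -> R) (r : R -> vertex T -> R) : Prop :=
  [/\ r 0 = r0,
      forall (t : R) i, 0 <= t -> 0 < r t i,
      forall i, r t i @[t --> 0^'+] --> r 0 i
    & forall (t : R) i, 0 < t ->
        is_derive t 1 (fun s => r s i)
          (- (curvature (r t) i - curvature_avg (r t)) * r t i)].

Definition converges_to (r : R -> vertex T -> R) (Koo roo : vertex T -> R) :=
  forall i, [/\ Koo i < 2 * pi, 0 < roo i,
    curvature (r t) i @[t --> +oo] --> Koo i & r t i @[t --> +oo] --> roo i].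

Definition convergent (r : R -> vertex T -> R) : Prop :=
  exists Koo roo, converges_to r Koo roo.

Definition exponentially_fast (r : R -> vertex T -> R) (Koo roo : vertex T -> R) :=
  exists c1 c2 : R, [/\ 0 < c1, 0 < c2 & forall (t : R) i, 0 <= t ->
    `|curvature (r t) i - Koo i| <= c1 * expR (- c2 * t) /\
    `|r t i - roo i| <= c1 * expR (- c2 * t)].

End Flow.

(* Main.v *)
Require Import Defs.
From mathcomp Require Import all_boot all_order all_algebra.
From mathcomp Require Import ring lra.
From mathcomp Require Import all_classical all_reals all_analysis.
(* restores the name [opp], which fractions also use *)
Import Defs.
Import Order.TTheory GRing.Theory Num.Theory numFieldNormedType.Exports.
Local Open Scope ring_scope.
Set Implicit Arguments.
Unset Strict Implicit.
Unset Printing Implicit Defensive.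

(** In the coordinates u_i = ln r_i the flow reads u_i' = - f_i, where f_i = K_i - kbar
is the excess of the curvature over its mean kbar = 2 pi chi(X) / N; by [gauss_bonnet]
the mean does not depend on the metric.

The geometric input is one triangle.  Its angle at the first corner depends only on
ratios of the radii, and its derivative in the logarithm of the second radius is a
[weight] that is symmetric in the two corners, non-negative and at most 3
([is_derive_packed_angle], [weight_ge0], [weight_le3]).  So the curvature is a globally
Lipschitz function of u ([curvature_exp_lipschitz]), which gives a solution for all
times ([ode_global_solution], [ricci_flow_exists]), and along the flow f' = - L f for a
weighted graph Laplacian L ([energy_deriv]).

Necessity.  A limit metric has all its curvatures equal to kbar
([curvature_limit_radius]), while every metric satisfies the strict inequality between
the sum of the K_i over I and the right-hand side of the condition, called
[limit_curvature] here ([limit_curvature_lt]).  Triangle by triangle this says that an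
angle opposite to the edge e is less than pi - Phi(e), and that two angles of a triangle
add up to less than pi; [curvature_sub] does the bookkeeping.

Sufficiency.  The two inequalities become equalities when the radii in I are
infinitesimal with respect to the others.  Hence, under the condition, a large gap
between the u_i in I and the other ones makes the sum of the f_i over I negative
([curvature_degenerating]), and the flow pushes the sum of the u_i over I up.  Therefore
the maximum over I of
<<
     - (sum of the u_i over I) - (G / 2) |I| (N - |I|)
>>
never increases: since the correction is strictly concave in |I|, a set I that attains
the maximum is separated from its complement by a gap G.  This bounds every u_i
([flow_log_bounded]).

Exponential convergence.  On a bounded set of u the weights are bounded below, except
that one weight of a triangle may vanish, and the other two then make up for it.  With
the connectedness of the surface ([poincare]) the sum of the f_i^2 is dissipated at a
rate proportional to itself ([energy_dissipation]), so it decays exponentially, and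
integrating u' = - f gives the convergence of the radii ([admissible_convergent]). *)

(** * Calculus on the half line and ordinary differential equations *)

Section Calculus.
Local Open Scope classical_set_scope.
Context {R : realType}.
Implicit Types (f g df : R -> R) (a b c s t : R).

Lemma is_derive_continuous f t c : is_derive t 1 f c -> {for t, continuous f}.
Proof. by case=> df _; apply/differentiable_continuous/derivable1_diffP. Qed.

Lemma right_MVT f df a b : a < b -> f x @[x --> a^'+] --> f a ->
  (forall t : R, a < t <= b -> is_derive t 1 f (df t)) ->
  exists2 c, a < c < b & f b - f a = df c * (b - a).
Proof.
move=> ab fa fd.
have [||c] := @MVT R f df a b ab.
- by move=> x; rewrite in_itv/= => /andP[ax xb]; apply: fd; rewrite ax ltW.
- apply/continuous_within_itvP => //; split => //.
    move=> x; rewrite in_itv/= => /andP[ax xb].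
    by apply: (is_derive_continuous (c := df x)); apply: fd; rewrite ax ltW.
  apply: cvg_at_left_filter.
  by apply: (is_derive_continuous (c := df b)); apply: fd; rewrite ab lexx.
by rewrite in_itv/= => cab ->; exists c.
Qed.

(** Differentiability is only asked away from the left end, as the flow gives it. *)
Lemma right_deriv_le0 f df a b : a <= b -> f x @[x --> a^'+] --> f a ->
  (forall t : R, a < t <= b -> is_derive t 1 f (df t)) ->
  (forall t : R, a < t <= b -> df t <= 0) -> f b <= f a.
Proof.
rewrite le_eqVlt => /predU1P[->//|ab] fa fd dle.
have [c /andP[ac cb] E] := right_MVT ab fa fd.
rewrite -subr_le0 E mulr_le0_ge0 ?subr_ge0 ?(ltW ab)//.
by rewrite dle// ac ltW.
Qed.

Lemma deriv_le0 f df a b : a <= b ->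
  (forall t : R, a <= t <= b -> is_derive t 1 f (df t)) ->
  (forall t : R, a <= t <= b -> df t <= 0) -> f b <= f a.
Proof.
move=> ab fd dle; apply: (right_deriv_le0 (df := df)) => //.
- apply: cvg_at_right_filter.
  by apply: (is_derive_continuous (c := df a)); apply: fd; rewrite lexx.
- by move=> t /andP[/ltW at_ tb]; apply: fd; rewrite at_ tb.
- by move=> t /andP[/ltW at_ tb]; apply: dle; rewrite at_ tb.
Qed.

Lemma is_derive_expRM (k t : R) :
  is_derive t 1 (fun s => expR (k * s)) (k * expR (k * t)).
Proof.
have kd : is_derive t 1 (fun s => k * s) k.
  have -> : (fun s => k * s) = k \*: id by [].
  by apply: is_derive_eq; rewrite /GRing.scale/= mulr1.
by rewrite mulrC; apply: is_derive1_comp.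
Qed.

Lemma antiderivative g : continuous g ->
  exists G : R -> R, G 0 = 0 /\ forall t : R, 0 <= t -> is_derive t 1 G (g t).
Proof.
move=> cg.
(* starting at -1 makes 0 an interior point *)
pose F x := (\int[@lebesgue_measure R]_(t in [set` `[-1, x]]) (g t))%R.
have FP t : 0 <= t -> is_derive t 1 F (g t).
  move=> t0.
  have [||||dF F'] := @continuous_FTC1_closed R g (-1) t (t + 1).
  - by rewrite ltrDl.
  - apply: continuous_compact_integrable; first exact: segment_compact.
    exact: continuous_subspaceT.
  - lra.
  - exact: cg.
  by rewrite -F' derive1E; apply: derivableP.
exists (fun t => F t - F 0); split; first by rewrite subrr.
move=> t t0; have Ft := FP t t0.
have -> : (fun t => F t - F 0) = F - cst (F 0) by [].
by apply: is_derive_eq; rewrite subr0.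
Qed.

(** The sequences u_k - 2c/2^k and u_k + 2c/2^k are monotone and enclose the limit. *)
Lemma geometric_cvg (u : nat -> R) c :
  (forall k, `|u k.+1 - u k| <= c / 2 ^+ k) ->
  exists l, forall k, `|u k - l| <= 2 * c / 2 ^+ k.
Proof.
move=> uP.
have p k : 2 ^+ k != 0 :> R by rewrite expf_neq0.
have hS k : c / 2 ^+ k = 2 * (c / 2 ^+ k.+1) by rewrite exprS; field.
pose lo k := u k - 2 * c / 2 ^+ k; pose hi k := u k + 2 * c / 2 ^+ k.
have loS k : lo k <= lo k.+1.
  have := uP k; have := hS k; rewrite ler_norml /lo -!mulrA => E /andP[]; lra.
have hiS k : hi k.+1 <= hi k.
  have := uP k; have := hS k; rewrite ler_norml /hi -!mulrA => E /andP[]; lra.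
have c0 k : 0 <= c / 2 ^+ k by apply: le_trans (uP k).
have lo_mono : {homo lo : m n / (m <= n)%N >-> m <= n}.
  by apply: homo_leq => // ? ? ?; apply: le_trans.
have hi_mono : {homo hi : m n / (m <= n)%N >-> n <= m}.
  by apply: homo_leq => // y x z /= H1 H2; exact: le_trans H2 H1.
have lohi m n : lo m <= hi n.
  apply: le_trans (hi_mono _ _ (leq_maxr m n)).
  apply: le_trans (lo_mono _ _ (leq_maxl m n)) _.
  have := c0 (maxn m n); rewrite /lo /hi -!mulrA; lra.
exists (sup (range lo)) => k.
have l1 : lo k <= sup (range lo).
  apply: ub_le_sup; last by exists k.
  by exists (hi 0%N) => _ [n _ <-].
have l2 : sup (range lo) <= hi k.
  by apply: ge_sup; [exists (lo 0%N), 0%N|move=> _ [n _ <-]].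
rewrite ler_norml; move: l1 l2; rewrite /lo /hi => l1 l2; apply/andP; split; lra.
Qed.

Lemma is_derive_bigsum (J : Type) (s : seq J) (P : pred J) (F : J -> R -> R)
    (dF : J -> R) (t : R) :
  (forall j, is_derive t 1 (F j) (dF j)) ->
  is_derive t 1 (fun u => \sum_(j <- s | P j) F j u) (\sum_(j <- s | P j) dF j).
Proof.
move=> H; elim: s => [|j s IH].
  rewrite big_nil; have -> : (fun u => \sum_(j <- [::] | P j) F j u) = cst 0.
    by apply/funext => u; rewrite big_nil.
  exact: is_derive_cst.
rewrite big_cons; case: ifP => Pj; last first.
  by under eq_fun do rewrite big_cons Pj.
have -> : (fun u => \sum_(j <- j :: s | P j) F j u) =
    F j + (fun u => \sum_(j <- s | P j) F j u).
  by apply/funext => u; rewrite big_cons Pj.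
exact: is_deriveD.
Qed.

Lemma cvg_bigsum (J U : Type) (s : seq J) (P : pred J) (G : set_system U)
    (F : J -> U -> R) (l : J -> R) : Filter G ->
  (forall j, F j u @[u --> G] --> l j) ->
  (\sum_(j <- s | P j) F j u) @[u --> G] --> \sum_(j <- s | P j) l j.
Proof.
move=> FG H; elim: s => [|j s IH].
  by rewrite big_nil; under eq_fun do rewrite big_nil; exact: cvg_cst.
rewrite big_cons; under eq_fun do rewrite big_cons.
by case: ifP => Pj //; apply: cvgD.
Qed.

(** At a maximum over an interval that ends at t or later, the difference quotients
from the left are non-negative. *)
Lemma deriv_ge0_at_left_max (f : R -> R) (a b t c : R) : a < t <= b ->
  is_derive t 1 f c -> (forall s, a <= s <= b -> f s <= f t) -> 0 <= c.
Proof.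
move=> /andP[at_ tb] /is_derive1_caratheodory[g [fE cg gc]] fmax.
rewrite leNgt; apply/negP => c0.
have /cvgrPdist_lt/(_ (- c)) := cg; rewrite oppr_gt0 => /(_ c0).
move=> /nbhs_ballP[e /= e0 He].
pose s := Num.max a (t - e / 2).
have st : s < t by rewrite gt_max at_ ltrBlDr ltrDl divr_gt0.
have s_ge : t - e / 2 <= s by rewrite le_max lexx orbT.
have as_ : a <= s by rewrite le_max lexx.
have : `|g t - g s| < - c.
  apply: He; rewrite /ball/= ger0_norm ?subr_ge0 ?(ltW st)//.
  by lra.
rewrite gc ltr_norml => /andP[gs _].
have gs0 : g s < 0 by lra.
have := fmax s; rewrite as_ (le_trans (ltW st) tb) => /(_ isT).
rewrite -subr_le0 fE leNgt => /negP; apply.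
by rewrite nmulr_rgt0// subr_lt0.
Qed.

(** Both f - A exp(- lam t), which increases, and f + A exp(- lam t), which decreases,
squeeze the limit. *)
Lemma exponential_limit (f df : R -> R) (A lam : R) : 0 < lam -> 0 <= A ->
  f x @[x --> 0^'+] --> f 0 ->
  (forall t : R, 0 < t -> is_derive t 1 f (df t)) ->
  (forall t : R, 0 < t -> `|df t| <= A * lam * expR (- lam * t)) ->
  exists l, forall t : R, 0 <= t -> `|f t - l| <= A * expR (- lam * t).
Proof.
move=> lam0 A0 f0 fd fb.
have e_gt0 t : 0 < expR (- lam * t) by apply: expR_gt0.
have mono (sg : R) : sg = 1 \/ sg = -1 -> forall s t : R, 0 <= s -> s <= t ->
    sg * f t + A * expR (- lam * t) <= sg * f s + A * expR (- lam * s).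
  move=> sgE s t s0 st.
  pose h := sg \*: f + A \*: (fun x => expR (- lam * x)).
  have hE x : h x = sg * f x + A * expR (- lam * x) by [].
  rewrite -!hE.
  apply: (right_deriv_le0 (df := fun x => sg *: df x + A *: (- lam * expR (- lam * x)))) => //.
  - have c1 : f x @[x --> s^'+] --> f s.
      move: s0; rewrite le_eqVlt => /predU1P[<-//|s0].
      by apply: cvg_at_right_filter; apply: (is_derive_continuous (fd _ s0)).
    have c2 : expR (- lam * x) @[x --> s^'+] --> expR (- lam * s).
      by apply: cvg_at_right_filter; apply: (is_derive_continuous (is_derive_expRM _ _)).
    by apply: cvgD; apply: cvgM => //; exact: cvg_cst.
  - move=> x /andP[sx _]; have := fd x (le_lt_trans s0 sx) => fx.
    by have := is_derive_expRM (- lam) x => ex; apply: is_derive_eq.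
  - move=> x /andP[sx _]; have := fb x (le_lt_trans s0 sx).
    rewrite ler_norml /GRing.scale/= => /andP[].
    by case: sgE => ->; lra.
have p_mono := mono 1 (or_introl erefl); have q_mono := mono (-1) (or_intror erefl).
pose q t := f t - A * expR (- lam * t).
have qp (s t : R) : 0 <= s -> 0 <= t -> q s <= f t + A * expR (- lam * t).
  move=> s0 t0; have := A0; rewrite /q.
  have [st|/ltW ts] := leP s t.
    have := q_mono s t s0 st; have := mulr_ge0 A0 (ltW (e_gt0 t)); lra.
  have := p_mono t s t0 ts; have := mulr_ge0 A0 (ltW (e_gt0 s)); lra.
pose S := [set q t | t in [set t : R | 0 <= t]].
exists (sup S) => t t0; rewrite ler_norml; apply/andP; split.
  rewrite lerBrDl -lerBrDr; apply: ge_sup; first by exists (q 0), 0 => //=.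
  by move=> _ [s /= s0 <-]; have := qp s t s0 t0; lra.
rewrite lerBlDr -lerBlDl; apply: ub_le_sup; last by exists t.
by exists (f 0 + A * expR (- lam * 0)) => _ [s /= s0 <-]; exact: qp.
Qed.

Lemma exponential_cvg (f : R -> R) (l A lam : R) : 0 < lam ->
  (forall t : R, 0 <= t -> `|f t - l| <= A * expR (- lam * t)) ->
  f t @[t --> +oo] --> l.
Proof.
move=> lam0 H; apply/cvgrPdist_le => e e0.
have A0 : 0 <= A.
  by have := le_trans (normr_ge0 _) (H 0 (lexx 0)); rewrite mulr0 expR0 mulr1.
near=> t; rewrite distrC.
have t0 : 0 <= t by near: t; apply: nbhs_pinfty_ge; exact: num_real.
have t1 : A / (lam * e) <= t by near: t; apply: nbhs_pinfty_ge; exact: num_real.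
apply: le_trans (H t t0) _.
rewrite mulNr expRN ler_pdivrMr ?expR_gt0//.
move: t1; rewrite ler_pdivrMr ?mulr_gt0// => t1.
apply: le_trans t1 _; rewrite mulrA mulrC ler_wpM2l ?(ltW e0)//.
by apply: le_trans (expR_ge1Dx _); rewrite mulrC; lra.
Unshelve. all: by end_near.
Qed.

(** The increments f(t+1) - f(t) tend to 0 and are values of the derivative at
arbitrarily late times. *)
Lemma deriv_limit_eq0 (f df : R -> R) (l c : R) :
  (forall t : R, 0 < t -> is_derive t 1 f (df t)) ->
  f t @[t --> +oo] --> l -> df t @[t --> +oo] --> c -> c = 0.
Proof.
move=> fd fl dfc; apply/eqP; apply: contrapT => /negP; rewrite -normr_gt0 => c0.
have c3 : 0 < `|c| / 3 by rewrite divr_gt0.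
have /cvgrPdist_lt/(_ _ c3) [M1 [_ H1]] := fl.
have /cvgrPdist_lt/(_ _ c3) [M2 [_ H2]] := dfc.
pose t := Num.max (Num.max M1 M2) 0 + 1.
have tM : M1 < t /\ M2 < t /\ 0 < t.
  by split; [|split]; rewrite /t ltr_pwDr// !le_max lexx ?orbT.
have [tM1 [tM2 t0]] := tM.
have tt1 : t < t + 1 by rewrite ltrDl.
have [||x /andP[tx xt] E] := right_MVT (f := f) (df := df) tt1.
- by apply: cvg_at_right_filter; apply: is_derive_continuous (fd _ t0).
- by move=> s /andP[ts _]; apply: fd; exact: lt_trans ts.
have := H1 t tM1; have := H1 (t + 1) (lt_trans tM1 tt1).
have := H2 x (lt_trans tM2 tx) => /= h1 h2 h3.
have {}E : f (t + 1) - f t = df x by rewrite E; ring.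
have : `|c| <= `|c - df x| + `|l - f t| + `|l - f (t + 1)|.
  have -> : c = (c - df x) + (l - f t) - (l - f (t + 1)) by rewrite -E; ring.
  have := ler_normB ((c - df x) + (l - f t)) (l - f (t + 1)).
  have := ler_normD (c - df x) (l - f t).
  move=> a1 a2; apply: le_trans a2 _; rewrite lerD2r (le_trans a1)//.
  have -> : c - df x + (l - f t) - (l - f (t + 1)) - df x = c - df x by rewrite -E; ring.
  by [].
lra.
Qed.

Lemma finite_pos_bound (J : finType) (P : J -> R -> Prop) :
  (forall j, exists2 d, 0 < d & P j d) ->
  (forall j (d d' : R), d' <= d -> P j d -> P j d') ->
  exists2 d, 0 < d & forall j, P j d.
Proof.
move=> H Hmono.
have H' j : exists d : R, 0 < d /\ P j d by have [d d0 Pd] := H j; exists d.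
have [d dP] := choice H'.
exists (\big[Num.min/1]_j d j); first by apply: lt_bigmin => // j _; case: (dP j).
by move=> j; apply: Hmono (dP j).2; apply: bigmin_le.
Qed.

End Calculus.

Section ODE.
Local Open Scope classical_set_scope.
Context {R : realType} {I : finType} (F : (I -> R) -> I -> R) (L : R).
Hypothesis L_gt0 : 0 < L.
Hypothesis F_lipschitz : forall u v c i,
  (forall j, `|u j - v j| <= c) -> `|F u i - F v i| <= L * c.
Implicit Types (v w : R -> I -> R).

Lemma lipschitz_field_continuous v i :
  (forall j, continuous (v^~ j)) -> continuous (fun t => F (v t) i).
Proof.
move=> cv t; apply/cvgrPdist_le => /= e e0.
have H : \forall s \near t, forall j, `|v t j - v s j| <= e / L.
  apply: (@filter_forall _ _ (fun j s => is_true (`|v t j - v s j| <= e / L)) (nbhs t) _) => j.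
  by have /cvgrPdist_le := cv j t; apply; rewrite divr_gt0.
near=> s.
have Hs : forall j, `|v t j - v s j| <= e / L by near: s.
by have := F_lipschitz i Hs; rewrite mulrCA mulfV ?mulr1 ?gt_eqF.
Unshelve. all: by end_near.
Qed.

Variable u0 : I -> R.

(** The integral operator whose fixed points solve the equation.  It only looks at the
half line: replacing t by its absolute value makes the iterates continuous on the whole
line, so that no one-sided continuity has to be carried along. *)
Lemma picard_operator : exists Psi : (R -> I -> R) -> R -> I -> R,
  forall v, (forall j, continuous (v^~ j)) ->
   [/\ forall j, continuous ((Psi v)^~ j),
       forall j, Psi v 0 j = u0 j,
       forall t : R, Psi v t = Psi v `|t|
     & forall j, exists U : R -> R, (forall t : R, 0 <= t -> U t = Psi v t j) /\
         forall t : R, 0 <= t -> is_derive t 1 U (F (v t) j)].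
Proof.
have H (g : R -> R) : exists G : R -> R, continuous g ->
    G 0 = 0 /\ forall t : R, 0 <= t -> is_derive t 1 G (g t).
  have [cg|ncg] := pselect (continuous g); last by exists (cst 0).
  by have [G] := antiderivative cg; exists G.
have [A AP] := choice H.
exists (fun v t i => u0 i + A (fun s => F (v s) i) `|t|) => v cv.
have {}AP i := AP _ (lipschitz_field_continuous (i := i) cv).
split.
- move=> j t; apply: cvgD; first exact: cvg_cst.
  apply: (@continuous_comp _ _ _ (fun t : R => `|t|) _); first exact: norm_continuous.
  by apply: is_derive_continuous; apply: (AP j).2.
- by move=> j; rewrite normr0 (AP j).1 addr0.
- by move=> t; rewrite normr_id.
- move=> j; exists (cst (u0 j) + A (fun s => F (v s) j)); split.
    by move=> t t0; rewrite ger0_norm.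
  move=> t t0; have ? := (AP j).2 t t0.
  by apply: is_derive_eq; rewrite add0r.
Qed.

(** In the norm weighted by exp(2 L |t|) the integral operator is a contraction of ratio
1/2 on the whole half line at once, so the Picard iterates converge for all times and
no local solutions have to be glued. *)
Theorem ode_global_solution : exists u : R -> I -> R,
  u 0 = u0 /\ forall (t : R) i, 0 <= t -> is_derive t 1 (u^~ i) (F (u t) i).
Proof.
have [Psi PsiP] := picard_operator.
(* the weight of the norm *)
pose e (t : R) := expR (2 * L * `|t|).
have e_gt0 t : 0 < e t by apply: expR_gt0.
have contr v w C : (forall j, continuous (v^~ j)) ->
    (forall j, continuous (w^~ j)) ->
    (forall t j, `|v t j - w t j| <= C * e t) ->
    forall t j, `|Psi v t j - Psi w t j| <= C / 2 * e t.
  move=> cv cw vw t j.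
  have [_ v0 ve vd] := PsiP v cv; have [_ w0 we wd] := PsiP w cw.
  have C0 : 0 <= C.
    by have := le_trans (normr_ge0 _) (vw 0 j); rewrite pmulr_lge0.
  have [U [UE Ud]] := vd j; have [W [WE Wd]] := wd j.
  have key (X Y : R -> R) (x y : R -> R) : X 0 = Y 0 ->
      (forall t : R, 0 <= t -> is_derive t 1 X (x t)) ->
      (forall t : R, 0 <= t -> is_derive t 1 Y (y t)) ->
      (forall t : R, 0 <= t -> x t - y t <= L * (C * e t)) ->
      X `|t| - Y `|t| <= C / 2 * e t.
    move=> XY Xd Yd xy.
    pose h := (X - Y) - (C / 2) \*: (fun s => expR (2 * L * s)).
    pose dh s := x s - y s - C / 2 *: (2 * L * expR (2 * L * s)).
    have hd (s : R) : 0 <= s <= `|t| -> is_derive s 1 h (dh s).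
      move=> /andP[s0 _]; have := Xd s s0; have := Yd s s0 => Ys Xs.
      by have := is_derive_expRM (2 * L) s => Es; apply: is_derive_eq.
    have : h `|t| <= h 0.
      apply: (deriv_le0 (df := dh)) => // s /andP[s0 _].
      have := xy s s0; rewrite /dh /GRing.scale/= /e (ger0_norm s0) => H.
      by rewrite subr_le0 (le_trans H)// le_eqVlt; apply/orP; left; apply/eqP; field.
    rewrite /h !fctE /= XY subrr mulr0 expR0 /GRing.scale/= mulr1 -/(e t) => H.
    lra.
  have Fb (s : R) : 0 <= s -> `|F (v s) j - F (w s) j| <= L * (C * e s).
    by move=> s0; apply: F_lipschitz => i.
  have UW : U 0 = W 0 by rewrite UE// WE// v0 w0.
  rewrite ve we -UE// -WE// ler_norml; apply/andP; split.
    rewrite lerNl opprB; apply: (key _ _ (fun s => F (w s) j) (fun s => F (v s) j)) => // s s0.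
    by apply: le_trans (ler_norm _) _; rewrite distrC Fb.
  apply: (key _ _ (fun s => F (v s) j) (fun s => F (w s) j)) => // s s0.
  by apply: le_trans (ler_norm _) _; rewrite Fb.
pose v k := iter k Psi (fun _ => u0).
have cv k j : continuous ((v k)^~ j).
  elim: k j => [|k IH] j; first exact: cst_continuous.
  by have [H _ _ _] := PsiP (v k) IH; exact: H.
pose C := (\sum_i `|F u0 i|) / (2 * L).
have vS k t j : `|v k.+1 t j - v k t j| <= C / 2 ^+ k * e t.
  elim: k t j => [|k IH] t j; last first.
    have := contr _ _ _ (cv k.+1) (cv k) IH t j.
    by rewrite exprS invfM (mulrC 2^-1) mulrA.
  have [_ v0 ve vd] := PsiP (v 0%N) (cv 0%N).
  have [U [UE Ud]] := vd j.
  have -> : v 1%N t j = U `|t| by rewrite UE// -ve.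
  rewrite -[v 0%N t j]v0 -UE//.
  have [||c _ ->] := @MVT_segment _ U (fun s => F (v 0%N s) j) 0 `|t| (normr_ge0 _).
  - by move=> x; rewrite in_itv/= => /andP[/ltW ? _]; apply: Ud.
  - apply: derivable_within_continuous => x; rewrite in_itv/= => /andP[x0 _].
    by have [] := Ud x x0.
  rewrite subr0 normrM normr_id expr0 divr1 /C.
  have Fs : `|F u0 j| <= \sum_i `|F u0 i|.
    by rewrite (bigD1 j)//= lerDl sumr_ge0.
  apply: le_trans (ler_wpM2r (normr_ge0 t) Fs) _.
  rewrite -mulrA ler_wpM2l ?sumr_ge0// mulrC ler_pdivlMr ?mulr_gt0//.
  rewrite mulrC /e; apply: le_trans (expR_ge1Dx _); lra.
have [u uP] : {u : R -> I -> R | forall t i k,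
    `|v k t i - u t i| <= 2 * (C * e t) / 2 ^+ k}.
  have H (p : R * I) : exists l, forall k,
      `|v k p.1 p.2 - l| <= 2 * (C * e p.1) / 2 ^+ k.
    apply: geometric_cvg => k; apply: le_trans (vS k _ _) _.
    by rewrite mulrAC.
  have [f fP] := choice H.
  by exists (fun t i => f (t, i)) => t i k; exact: (fP (t, i)).
have lim0 (a : R) : forall eps : R, 0 < eps -> exists k, `|a / 2 ^+ k| < eps.
  move=> eps eps0.
  have : geometric a (2^-1) n @[n --> \oo] --> (0 : R).
    by apply: cvg_geometric; rewrite gtr0_norm; lra.
  move=> /cvgr0Pnorm_lt /(_ eps eps0) [k _ /(_ k (leqnn k))] /=.
  by rewrite exprVn => H; exists k.
have cu j : continuous (u^~ j).
  move=> t; apply/cvgrPdist_lt => /= eps eps0.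
  have eps2 : 0 < eps / 2 by lra.
  have [k Hk] := lim0 (2 * C * (2 * e t + 1)) (eps / 2) eps2.
  have ce : continuous e.
    move=> s; rewrite /e; apply: (@continuous_comp _ _ _ (fun s : R => 2 * L * `|s|) expR).
      by apply: cvgM; [exact: cvg_cst|exact: norm_continuous].
    exact: continuous_expR.
  near=> s.
  have es : `|e t - e s| < 1 by near: s; have /cvgrPdist_lt := ce t; apply.
  have vs : `|v k t j - v k s j| < eps / 2.
    by near: s; have /cvgrPdist_lt := cv k j t; apply; lra.
  have us := uP s j k; have ut := uP t j k.
  have -> : u t j - u s j = (u t j - v k t j) + (v k t j - v k s j) + (v k s j - u s j).
    by ring.
  apply: le_lt_trans (ler_normD _ _) _.
  apply: le_lt_trans (lerD (ler_normD _ _) (lexx _)) _.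
  rewrite (distrC (u t j)).
  have CC : 0 <= 2 * C / 2 ^+ k.
    apply: divr_ge0; last exact: exprn_ge0.
    by rewrite mulr_ge0// /C divr_ge0 ?sumr_ge0// mulr_ge0// ltW.
  have : 2 * C / 2 ^+ k * e s <= 2 * C / 2 ^+ k * (e t + 1).
    by apply: ler_wpM2l => //; move: es; rewrite ltr_norml => /andP[]; lra.
  have E1 x : 2 * (C * x) / 2 ^+ k = 2 * C / 2 ^+ k * x by rewrite mulrA mulrAC.
  have Hk' := le_lt_trans (ler_norm _) Hk.
  move: us ut vs; rewrite !E1 => us ut vs.
  have : 2 * C / 2 ^+ k * (2 * e t + 1) < eps / 2 by rewrite mulrAC.
  lra.
have [_ P0 Pe Pd] := PsiP u cu.
have uE (t : R) j : 0 <= t -> Psi u t j = u t j.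
  move=> t0; apply/eqP; rewrite -subr_eq0 -normr_le0; apply/ler_addgt0Pl => eps eps0.
  have [k Hk] := lim0 (2 * C * e t) eps eps0; rewrite addr0.
  have H := contr _ _ (2 * C / 2 ^+ k) cu (cv k) _ t j.
  have {}H : `|Psi u t j - v k.+1 t j| <= 2 * C / 2 ^+ k / 2 * e t.
    apply: H => s i; rewrite distrC; apply: le_trans (uP s i k) _.
    by rewrite mulrA mulrAC.
  have -> : Psi u t j - u t j = (Psi u t j - v k.+1 t j) + (v k.+1 t j - u t j) by ring.
  apply: le_trans (ler_normD _ _) _.
  have := uP t j k.+1; rewrite exprS.
  have -> : 2 * (C * e t) / (2 * 2 ^+ k) = 2 * C / 2 ^+ k / 2 * e t.
    by field; rewrite expf_neq0.
  have {}Hk := le_lt_trans (ler_norm _) Hk.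
  rewrite (mulrAC (2 * C / _)) (mulrAC (2 * C) _ (e t)) in H *.
  move: H; set z := 2 * C * e t / 2 ^+ k in Hk *; lra.
have [U UP] := choice Pd.
exists (fun t j => U j t); split.
  by apply/funext => j; rewrite (UP j).1.
move=> t i t0; have -> : (fun j => U j t) = u t.
  by apply/funext => j; rewrite (UP j).1// uE.
exact: (UP i).2.
Unshelve. all: by end_near.
Qed.

End ODE.

(** * The law of cosines *)

Section LawOfCosines.
Local Open Scope classical_set_scope.
Context {R : realType}.
Implicit Types (A B C : R).

Definition law_of_cosines A B C : R :=
  acos ((A + B - C) / (2 * Num.sqrt A * Num.sqrt B)).

(** By Heron, sixteen times the squared area of the triangle with squared sides A, B, C. *)
Definition area16 A B C : R := 4 * A * B - (A + B - C) ^+ 2.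

Lemma area16_perm A B C : area16 B C A = area16 A B C.
Proof. by rewrite /area16; ring. Qed.

Section Nondegenerate.
Variables A B C : R.
Hypotheses (A_gt0 : 0 < A) (B_gt0 : 0 < B) (area_gt0 : 0 < area16 A B C).

Let cosine := (A + B - C) / (2 * Num.sqrt A * Num.sqrt B).

Let sqrtA_gt0 : 0 < Num.sqrt A. Proof. by rewrite sqrtr_gt0. Qed.
Let sqrtB_gt0 : 0 < Num.sqrt B. Proof. by rewrite sqrtr_gt0. Qed.

Let sin2 : 1 - cosine ^+ 2 = area16 A B C / (2 * Num.sqrt A * Num.sqrt B) ^+ 2.
Proof.
rewrite /cosine expr_div_n !exprMn !sqr_sqrtr ?ltW// /area16.
by field; rewrite !gt_eqF.
Qed.

Lemma law_of_cosines_itv : -1 < cosine < 1.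
Proof.
rewrite -ltr_norml -(@expr_lt1 _ 2)// ?normr_ge0// real_normK ?num_real//.
by rewrite -subr_gt0 sin2 divr_gt0// exprn_gt0// !mulr_gt0.
Qed.

Lemma cos_law_of_cosines : cos (law_of_cosines A B C) = cosine.
Proof. by rewrite acosK// in_itv/=; case/andP: law_of_cosines_itv => /ltW-> /ltW->. Qed.

Lemma law_of_cosines_gt0 : 0 < law_of_cosines A B C.
Proof. by apply: acos_gt0; case/andP: law_of_cosines_itv => /ltW-> ->. Qed.

Lemma law_of_cosines_ltpi : law_of_cosines A B C < pi.
Proof. by apply: acos_ltpi; case/andP: law_of_cosines_itv => -> /ltW->. Qed.

Lemma sin_law_of_cosines :
  sin (law_of_cosines A B C) =
  Num.sqrt (area16 A B C) / (2 * Num.sqrt A * Num.sqrt B).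
Proof.
rewrite sin_acos; last by case/andP: law_of_cosines_itv => /ltW-> /ltW->.
rewrite sin2 sqrtrM ?(ltW area_gt0)// -exprVn sqrtr_sqr.
by rewrite ger0_norm// invr_ge0 !mulr_ge0.
Qed.

End Nondegenerate.

(** The addition formulas give cos(p + q) = - cos r and sin(p + q) > 0 for the three angles
p, q, r; the second rules out p + q > pi, and cos is injective on [0, pi]. *)
Lemma angle_sum A B C : 0 < A -> 0 < B -> 0 < C -> 0 < area16 A B C ->
  law_of_cosines A B C + law_of_cosines B C A + law_of_cosines C A B = pi.
Proof.
have sE (X : R) : 0 < X -> exists2 s, 0 < s & X = s ^+ 2.
  by move=> X0; exists (Num.sqrt X); rewrite ?sqrtr_gt0// sqr_sqrtr// ltW.
move=> /[dup] A0 /sE[a a0 EA] /[dup] B0 /sE[b b0 EB] /[dup] C0 /sE[c c0 EC] S0.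
have S1 : 0 < area16 B C A by rewrite area16_perm.
have S2 : 0 < area16 C A B by rewrite area16_perm.
set p := law_of_cosines A B C; set q := law_of_cosines B C A.
set r := law_of_cosines C A B.
have p0 : 0 < p by exact: law_of_cosines_gt0.
have q0 : 0 < q by exact: law_of_cosines_gt0.
have ppi : p < pi by exact: law_of_cosines_ltpi.
have qpi : q < pi by exact: law_of_cosines_ltpi.
have [sA [sB sC]] : Num.sqrt A = a /\ Num.sqrt B = b /\ Num.sqrt C = c.
  by rewrite EA EB EC !sqrtr_sqr !gtr0_norm.
have cosD' : cos (p + q) = - cos r.
  rewrite cosD !cos_law_of_cosines// !sin_law_of_cosines// (area16_perm A B C).
  rewrite sA sB sC !mulf_div -expr2 sqr_sqrtr ?(ltW S0)// /area16 EA EB EC.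
  by field; rewrite !gt_eqF.
have sinD' : 0 < sin (p + q).
  rewrite sinD !cos_law_of_cosines// !sin_law_of_cosines// (area16_perm A B C).
  have s0 : 0 < Num.sqrt (area16 A B C) by rewrite sqrtr_gt0.
  set s := Num.sqrt _ in s0 *; rewrite sA sB sC.
  suff -> : s / (2 * a * b) * ((B + C - A) / (2 * b * c)) +
      (A + B - C) / (2 * a * b) * (s / (2 * b * c)) = s / (2 * a * c).
    by rewrite divr_gt0 ?mulr_gt0.
  by rewrite EB; field; rewrite !gt_eqF.
have pq : p + q <= pi.
  rewrite leNgt; apply/negP => h; move: sinD'; rewrite ltNge => /negP; apply.
  have : 0 <= sin (p + q - pi) by apply: sin_ge0_pi; apply/andP; split; lra.
  by rewrite sinB cospi sinpi mulr0 subr0 mulrN1 oppr_ge0.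
suff : p + q = pi - r by move=> ->; rewrite subrK.
have r0 : 0 < r by exact: law_of_cosines_gt0.
have rpi : r < pi by exact: law_of_cosines_ltpi.
apply: cos_inj; rewrite ?in_itv/=.
- by apply/andP; split; lra.
- by apply/andP; split; lra.
by rewrite cosD' addrC cosDpi cosN.
Qed.

(** The factor relating the derivative of the cosine to that of the angle is minus the
sine, which is the square root of [area16] over twice the product of the sides. *)
Lemma is_derive_law_of_cosines (A B C : R -> R) (t dA dB dC : R) :
  is_derive t 1 A dA -> is_derive t 1 B dB -> is_derive t 1 C dC ->
  0 < A t -> 0 < B t -> 0 < area16 (A t) (B t) (C t) ->
  is_derive t 1 (fun s => law_of_cosines (A s) (B s) (C s))
    (- (dA + dB - dC - (A t + B t - C t) * (dA / (2 * A t) + dB / (2 * B t)))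
     / Num.sqrt (area16 (A t) (B t) (C t))).
Proof.
move=> hA hB hC A0 B0 S0.
have a0 : 0 < Num.sqrt (A t) by rewrite sqrtr_gt0.
have b0 : 0 < Num.sqrt (B t) by rewrite sqrtr_gt0.
have hsA := is_derive1_comp (is_derive1_sqrt A0) hA.
have hsB := is_derive1_comp (is_derive1_sqrt B0) hB.
have hN : is_derive t 1 (A + B - C) (dA + dB - dC) by apply: is_derive_eq.
have hP : is_derive t 1 (2 \*: ((Num.sqrt \o A) * (Num.sqrt \o B)))
   (2 *: (Num.sqrt (A t) *: ((2 * Num.sqrt (B t))^-1 * dB)
    + Num.sqrt (B t) *: ((2 * Num.sqrt (A t))^-1 * dA))).
  by apply: is_derive_eq.
have Pn : (2 \*: ((Num.sqrt \o A) * (Num.sqrt \o B))) t != 0.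
  by rewrite !fctE /= /GRing.scale/= mulf_neq0// ?mulf_neq0// gt_eqF.
have hQ := is_deriveM hN (is_deriveV Pn hP).
have itv := law_of_cosines_itv A0 B0 S0.
pose h : R -> R := ((A + B - C) * (fun y => ((2 \*: ((Num.sqrt \o A) * (Num.sqrt \o B))) y)^-1)).
have hE s : h s = (A s + B s - C s) / (2 * Num.sqrt (A s) * Num.sqrt (B s)).
  by rewrite /h !fctE /= /GRing.scale/= mulrA.
have hac : is_derive (h t) 1 (@acos R) (- (Num.sqrt (1 - h t ^+ 2))^-1).
  by apply: is_derive1_acos; rewrite hE.
have H := is_derive1_comp hac hQ.
have -> : (fun s => law_of_cosines (A s) (B s) (C s)) = acos \o h.
  by apply/funext => s /=; rewrite hE.
apply: (is_derive_eq H).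
rewrite hE -sin_acos; last by case/andP: itv => /ltW -> /ltW ->.
rewrite sin_law_of_cosines// !fctE /= /GRing.scale/=.
have s0 : 0 < Num.sqrt (area16 (A t) (B t) (C t)) by rewrite sqrtr_gt0.
set a := Num.sqrt (A t) in a0 *; set b := Num.sqrt (B t) in b0 *.
set s := Num.sqrt (area16 _ _ _) in s0 *.
have -> : A t = a ^+ 2 by rewrite sqr_sqrtr ?ltW.
have -> : B t = b ^+ 2 by rewrite sqr_sqrtr ?ltW.
by field; rewrite !gt_eqF.
Qed.

End LawOfCosines.

(** * Triangles of a circle packing *)

Lemma subr1_sqr_ge0 (R : realType) (c : R) : 0 <= c <= 1 -> 0 <= 1 - c ^+ 2.
Proof. by move=> /andP[c0 c1]; rewrite subr_ge0 expr_le1. Qed.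

Ltac nonneg := repeat first
  [ assumption | exact: ler01 | exact: ler0n | exact: sqr_ge0 | by apply: ltW
  | by apply: subr1_sqr_ge0 | apply: exprn_ge0 | apply: mulr_ge0 | apply: addr_ge0 ].

Section PackedTriangle.
Local Open Scope classical_set_scope.
Context {R : realType}.
Implicit Types (x y z g a b : R).

Definition sqr_length x y g : R := x ^+ 2 + y ^+ 2 + 2 * x * y * g.

Definition packed_angle x y z g a b : R :=
  law_of_cosines (sqr_length x y g) (sqr_length z x b) (sqr_length y z a).

(** Four times the squared area, expanded so that all its terms are visibly non-negative
when the cosines g, a, b of the edges xy, yz, zx lie in [0, 1]. *)
Definition area4 x y z g a b : R :=
  x ^+ 2 * y ^+ 2 * (1 - g ^+ 2) + x ^+ 2 * z ^+ 2 * (1 - b ^+ 2)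
  + y ^+ 2 * z ^+ 2 * (1 - a ^+ 2)
  + 2 * x * y * z * (x * (a + b * g) + y * (b + a * g) + z * (g + a * b)).

Definition cos_num x y z g a b : R := x ^+ 2 + x * y * g + x * z * b - y * z * a.

Definition weight_num x y z g a b : R :=
  x * y * (1 - g ^+ 2) + x * z * (a + b * g) + y * z * (b + a * g).

(** The derivative of the angle at the corner x in the logarithm of y.  Exchanging x and y
(and a and b) does not change it, which is the integrability of the angles. *)
Definition weight x y z g a b : R :=
  x * y * weight_num x y z g a b / (sqr_length x y g * Num.sqrt (area4 x y z g a b)).

Lemma sqr_lengthC x y g : sqr_length y x g = sqr_length x y g.
Proof. by rewrite /sqr_length; ring. Qed.

Lemma area4_cycle x y z g a b : area4 y z x a b g = area4 x y z g a b.
Proof. by rewrite /area4; ring. Qed.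

Lemma area4E x y z g a b : area4 x y z g a b =
  sqr_length x y g * sqr_length z x b - cos_num x y z g a b ^+ 2.
Proof. by rewrite /area4 /sqr_length /cos_num; ring. Qed.

Lemma area16_area4 x y z g a b :
  area16 (sqr_length x y g) (sqr_length z x b) (sqr_length y z a) = 4 * area4 x y z g a b.
Proof. by rewrite /area16 /area4 /sqr_length; ring. Qed.

(** Completing the square in z: the square of the numerator is a multiple of [area4] up
to a remainder that [area4] controls as well. *)
Lemma weight_num_sqr x y z g a b :
  (x * y * weight_num x y z g a b) ^+ 2 =
  x ^+ 2 * y ^+ 2 * (1 - g ^+ 2) * area4 x y z g a b
  + x ^+ 2 * y ^+ 2 * z ^+ 2 * sqr_length x y g
    * (a ^+ 2 + b ^+ 2 + g ^+ 2 + 2 * a * b * g - 1).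
Proof. by rewrite /weight_num /area4 /sqr_length; ring. Qed.

Section Positive.
Variables x y z g a b : R.
Hypotheses (x_gt0 : 0 < x) (y_gt0 : 0 < y) (z_gt0 : 0 < z).
Hypotheses (g01 : 0 <= g <= 1) (a01 : 0 <= a <= 1) (b01 : 0 <= b <= 1).

Let g0 : 0 <= g. Proof. by case/andP: g01. Qed.
Let a0 : 0 <= a. Proof. by case/andP: a01. Qed.
Let b0 : 0 <= b. Proof. by case/andP: b01. Qed.

Lemma sqr_length_ge_sumsqr : x ^+ 2 + y ^+ 2 <= sqr_length x y g.
Proof. by rewrite /sqr_length lerDl !mulr_ge0// ltW. Qed.

Lemma sqr_length_gt0 : 0 < sqr_length x y g.
Proof. by apply: lt_le_trans sqr_length_ge_sumsqr; rewrite addr_gt0// exprn_gt0. Qed.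

Lemma sqr_length_le_sqr : sqr_length x y g <= (x + y) ^+ 2.
Proof.
have [_ g1] := andP g01; rewrite -subr_ge0.
have -> : (x + y) ^+ 2 - sqr_length x y g = 2 * (x * y * (1 - g)) by rewrite /sqr_length; ring.
by rewrite !mulr_ge0 ?subr_ge0// ltW.
Qed.

Lemma area4_ge : z ^+ 2 * (x ^+ 2 * (1 - b ^+ 2) + y ^+ 2 * (1 - a ^+ 2)
   + 2 * x * y * (g + a * b)) <= area4 x y z g a b.
Proof.
rewrite -subr_ge0.
have -> : area4 x y z g a b - z ^+ 2 * (x ^+ 2 * (1 - b ^+ 2) +
    y ^+ 2 * (1 - a ^+ 2) + 2 * x * y * (g + a * b)) =
    x ^+ 2 * y ^+ 2 * (1 - g ^+ 2) +
    2 * x * y * z * (x * (a + b * g) + y * (b + a * g)) by rewrite /area4; ring.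
have [[x0 y0] z0] := (ltW x_gt0, ltW y_gt0, ltW z_gt0).
nonneg.
Qed.

Lemma area4_gt0 : 0 < area4 x y z g a b.
Proof.
have [[x0 y0] z0] := (ltW x_gt0, ltW y_gt0, ltW z_gt0).
have h1 : 0 <= x ^+ 2 * z ^+ 2 * (1 - b ^+ 2).
  nonneg.
have h2 : 0 <= y ^+ 2 * z ^+ 2 * (1 - a ^+ 2).
  nonneg.
have h3 : 0 <= 2 * x * y * z * (x * (a + b * g) + y * (b + a * g) + z * (a * b)).
  nonneg.
have h4 : 0 < x ^+ 2 * y ^+ 2 * (1 - g ^+ 2) + 2 * x * y * z ^+ 2 * g.
  have [g_lt1|] := ltP g 1.
    rewrite ltr_wpDr// ?mulr_ge0// ?exprn_ge0//.
    by rewrite !mulr_gt0// ?exprn_gt0// subr_gt0 expr_lt1.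
  move=> g1; rewrite ltr_wpDl// ?mulr_ge0// ?exprn_ge0// ?subr1_sqr_ge0//.
  by rewrite !mulr_gt0 ?exprn_gt0// (lt_le_trans _ g1).
have -> : area4 x y z g a b =
   (x ^+ 2 * y ^+ 2 * (1 - g ^+ 2) + 2 * x * y * z ^+ 2 * g)
   + x ^+ 2 * z ^+ 2 * (1 - b ^+ 2) + y ^+ 2 * z ^+ 2 * (1 - a ^+ 2)
   + 2 * x * y * z * (x * (a + b * g) + y * (b + a * g) + z * (a * b)).
  by rewrite /area4; ring.
by apply: ltr_wpDr h3 _; apply: ltr_wpDr h2 _; apply: ltr_wpDr h1 h4.
Qed.

Lemma weight_num_ge0 : 0 <= weight_num x y z g a b.
Proof.
have [[x0 y0] z0] := (ltW x_gt0, ltW y_gt0, ltW z_gt0).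
by rewrite /weight_num; nonneg.
Qed.

Lemma weight_ge0 : 0 <= weight x y z g a b.
Proof.
by rewrite divr_ge0 ?mulr_ge0 ?weight_num_ge0 ?sqrtr_ge0// ltW// sqr_length_gt0.
Qed.

(** By [weight_num_sqr] the square of the weight is at most 1, because x y is at most the
squared length of the edge, plus 4 times x^2 y^2 z^2 over the product of this squared
length and [area4]; the last quotient is at most 1 by the terms of [area4] in z^2. *)
Lemma weight_le3 : weight x y z g a b <= 3.
Proof.
have S0 := sqr_length_gt0; have D0 := area4_gt0; set D := area4 _ _ _ _ _ _ in D0.
set S := sqr_length x y g in S0.
have [[x0 y0] z0] := (ltW x_gt0, ltW y_gt0, ltW z_gt0).
have [[[_ g1] [_ a1]] [_ b1]] := (andP g01, andP a01, andP b01).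
have den_gt0 : 0 < S * Num.sqrt D by rewrite mulr_gt0 ?sqrtr_gt0.
rewrite ler_pdivrMr// -(@ler_pXn2r _ 2)// ?nnegrE; last 2 first.
- by rewrite mulr_ge0 ?weight_num_ge0// mulr_ge0.
- by rewrite mulr_ge0// ltW.
rewrite weight_num_sqr !exprMn sqr_sqrtr ?(ltW D0)// -/D -/S.
have S_ge : x ^+ 2 + y ^+ 2 <= S by exact: sqr_length_ge_sumsqr.
have xyS : x ^+ 2 * y ^+ 2 <= S ^+ 2.
  have -> : x ^+ 2 * y ^+ 2 = (x * y) ^+ 2 by ring.
  rewrite ler_pXn2r ?nnegrE ?mulr_ge0 ?(ltW S0)//; apply: le_trans S_ge.
  by have := sqr_ge0 (x - y); have := sqr_ge0 x; have := sqr_ge0 y; rewrite !expr2; nra.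
have ab0 : 0 <= 1 - a ^+ 2 - b ^+ 2 + 4 * a * b.
  have [ab|ba] := leP a b.
    have : a * a <= a * b by rewrite ler_wpM2l.
    have : 0 <= 1 - b ^+ 2 by apply: subr1_sqr_ge0.
    have : 0 <= a * b by rewrite mulr_ge0.
    by rewrite !expr2; lra.
  have : b * b <= a * b by rewrite ler_wpM2r// ltW.
  have : 0 <= 1 - a ^+ 2 by apply: subr1_sqr_ge0.
  have : 0 <= a * b by rewrite mulr_ge0.
  by rewrite !expr2; lra.
pose s := x ^+ 2 * (1 - b ^+ 2) + y ^+ 2 * (1 - a ^+ 2) + 2 * x * y * (g + a * b).
have Ss : x ^+ 2 * y ^+ 2 <= S * s.
  have s0 : 0 <= s by rewrite /s; nonneg.
  apply: le_trans (ler_wpM2r s0 S_ge); rewrite -subr_ge0.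
  have -> : (x ^+ 2 + y ^+ 2) * s - x ^+ 2 * y ^+ 2 =
    x ^+ 4 * (1 - b ^+ 2) + y ^+ 4 * (1 - a ^+ 2) +
    2 * x * y * (x ^+ 2 + y ^+ 2) * g + 2 * x * y * (x - y) ^+ 2 * (a * b)
    + x ^+ 2 * y ^+ 2 * (1 - a ^+ 2 - b ^+ 2 + 4 * a * b) by rewrite /s; ring.
  nonneg.
have Dz : z ^+ 2 * s <= D by exact: area4_ge.
have SD : x ^+ 2 * y ^+ 2 * z ^+ 2 <= S * D.
  apply: le_trans (ler_wpM2l (ltW S0) Dz).
  have -> : S * (z ^+ 2 * s) = S * s * z ^+ 2 by ring.
  by apply: ler_wpM2r => //; apply: exprn_ge0.
have delta4 : a ^+ 2 + b ^+ 2 + g ^+ 2 + 2 * a * b * g - 1 <= 4.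
  have := subr1_sqr_ge0 a01; have := subr1_sqr_ge0 b01; have := subr1_sqr_ge0 g01.
  have : a * b * g <= 1 by rewrite !mulr_ile1 ?mulr_ge0.
  lra.
have H1 : x ^+ 2 * y ^+ 2 * (1 - g ^+ 2) * D <= S ^+ 2 * D.
  rewrite ler_wpM2r ?(ltW D0)//; apply: le_trans xyS.
  by rewrite ler_piMr ?mulr_ge0 ?exprn_ge0// gerBl exprn_ge0.
have H2 : x ^+ 2 * y ^+ 2 * z ^+ 2 * S *
    (a ^+ 2 + b ^+ 2 + g ^+ 2 + 2 * a * b * g - 1) <= S * D * S * 4.
  apply: le_trans (ler_wpM2l _ delta4) _.
    by rewrite !mulr_ge0 ?exprn_ge0// ltW.
  by rewrite ler_wpM2r// ler_wpM2r// ltW.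
apply: le_trans (lerD H1 H2) _.
have : 0 < S ^+ 2 * D by rewrite mulr_gt0 ?exprn_gt0.
rewrite !expr2; lra.
Qed.

Lemma cos_packed_angle : cos (packed_angle x y z g a b) =
  cos_num x y z g a b / (Num.sqrt (sqr_length x y g) * Num.sqrt (sqr_length z x b)).
Proof.
rewrite cos_law_of_cosines ?area16_area4 ?mulr_gt0 ?area4_gt0 ?sqr_length_gt0//.
- have -> : sqr_length x y g + sqr_length z x b - sqr_length y z a = 2 * cos_num x y z g a b.
    by rewrite /sqr_length /cos_num; ring.
  by rewrite -[2 * Num.sqrt _ * _]mulrA -mulf_div divff ?mul1r.
- by rewrite /sqr_length ltr_wpDr ?mulr_ge0 ?(ltW x_gt0) ?(ltW z_gt0)// addr_gt0 ?exprn_gt0.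
Qed.

End Positive.

Section PositiveAngles.
Variables x y z g a b : R.
Hypotheses (x_gt0 : 0 < x) (y_gt0 : 0 < y) (z_gt0 : 0 < z).
Hypotheses (g01 : 0 <= g <= 1) (a01 : 0 <= a <= 1) (b01 : 0 <= b <= 1).

Lemma packed_angle_gt0 : 0 < packed_angle x y z g a b.
Proof.
by rewrite law_of_cosines_gt0 ?area16_area4 ?mulr_gt0 ?area4_gt0 ?sqr_length_gt0.
Qed.

Lemma packed_angle_ltpi : packed_angle x y z g a b < pi.
Proof.
by rewrite law_of_cosines_ltpi ?area16_area4 ?mulr_gt0 ?area4_gt0 ?sqr_length_gt0.
Qed.

Lemma packed_angle_sum : packed_angle x y z g a b + packed_angle y z x a b g
  + packed_angle z x y b g a = pi.
Proof.
have := @angle_sum R (sqr_length x y g) (sqr_length z x b) (sqr_length y z a).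
rewrite area16_area4 !(sqr_length_gt0, area4_gt0, mulr_gt0)// => <-//.
by rewrite addrAC.
Qed.

(** The factor 1 - g + a + b vanishes only if g = 1 and a = b = 0, that is, if the first two
circles are tangent and the third one is orthogonal to both.  In that case the weight
itself is zero, so no bound without this factor holds. *)
Lemma weight_ge m M : 0 < m -> m <= x <= M -> m <= y <= M -> m <= z <= M ->
  m ^+ 4 / (16 * M ^+ 4) * (1 - g + a + b) <= weight x y z g a b.
Proof.
move=> m0 /andP[mx xM] /andP[my yM] /andP[mz zM].
have M0 : 0 < M by apply: lt_le_trans xM.
have [[x0 y0] z0] := (ltW x_gt0, ltW y_gt0, ltW z_gt0).
have [[[g0 g1] [a0 a1]] [b0 b1]] := (andP g01, andP a01, andP b01).
have sideM (u v c : R) : 0 < u -> 0 < v -> u <= M -> v <= M -> 0 <= c <= 1 ->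
    sqr_length u v c <= 4 * M ^+ 2.
  move=> u0 v0 uM vM c01; apply: le_trans (sqr_length_le_sqr u0 v0 c01) _.
  have -> : 4 * M ^+ 2 = (M + M) ^+ 2 by ring.
  by rewrite ler_pXn2r ?nnegrE ?addr_ge0 ?lerD// ltW.
have S0 := sqr_length_gt0 x_gt0 y_gt0 g01; have D0 := area4_gt0 x_gt0 y_gt0 z_gt0 g01 a01 b01.
have SM := sideM _ _ _ x_gt0 y_gt0 xM yM g01.
have DM : area4 x y z g a b <= (4 * M ^+ 2) ^+ 2.
  apply: (@le_trans _ _ (sqr_length x y g * sqr_length z x b)).
    by rewrite area4E gerBl sqr_ge0.
  by rewrite expr2 ler_pM ?sideM// ltW// sqr_length_gt0.
have sDM : Num.sqrt (area4 x y z g a b) <= 4 * M ^+ 2.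
  have -> : 4 * M ^+ 2 = Num.sqrt ((4 * M ^+ 2) ^+ 2).
    by rewrite sqrtr_sqr ger0_norm// mulr_ge0// exprn_ge0// ltW.
  by rewrite ler_sqrt// exprn_ge0// mulr_ge0// exprn_ge0// ltW.
rewrite /weight mulrAC; apply: ler_pM.
- have ? : 0 <= 1 - g + a + b by lra.
  by rewrite mulr_ge0// exprn_ge0// ltW.
- by rewrite invr_ge0 mulr_ge0// exprn_ge0// ltW.
- have mm (u v : R) : m <= u -> m <= v -> m ^+ 2 <= u * v.
    by move=> mu mv; rewrite expr2 ler_pM// ltW.
  have m20 : 0 <= m ^+ 2 by rewrite exprn_ge0// ltW.
  have c0 : 0 <= 1 - g + a + b by lra.
  have -> : m ^+ 4 * (1 - g + a + b) = m ^+ 2 * (m ^+ 2 * (1 - g + a + b)) by ring.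
  apply: ler_pM => //; first exact: mulr_ge0.
    exact: mm.
  apply: (@le_trans _ _ (m ^+ 2 * (1 - g ^+ 2) + m ^+ 2 * (a + b * g) + m ^+ 2 * (b + a * g))).
    rewrite -!mulrDr ler_wpM2l//.
    have : 0 <= g * (1 - g) by rewrite mulr_ge0// subr_ge0.
    have : 0 <= b * g by rewrite mulr_ge0.
    have : 0 <= a * g by rewrite mulr_ge0.
    by rewrite expr2; lra.
  rewrite /weight_num; apply: lerD; first apply: lerD.
  + by apply: ler_wpM2r; [exact: subr1_sqr_ge0|exact: mm].
  + by apply: ler_wpM2r; [nonneg|exact: mm].
  + by apply: ler_wpM2r; [nonneg|exact: mm].
- rewrite lef_pV2 ?posrE ?mulr_gt0 ?exprn_gt0 ?sqrtr_gt0//.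
  have -> : 16 * M ^+ 4 = (4 * M ^+ 2) * (4 * M ^+ 2) by ring.
  by rewrite ler_pM// ?sqrtr_ge0// ltW.
Qed.

End PositiveAngles.

(** Angles are invariant under scaling, so only the differences of the logarithmic speeds
xi, eta, zeta of the radii appear.  The second weight belongs to the edge zx. *)
Lemma is_derive_packed_angle (x y z : R -> R) (t xi eta zeta g a b : R) :
  is_derive t 1 x (x t * xi) -> is_derive t 1 y (y t * eta) ->
  is_derive t 1 z (z t * zeta) -> 0 < x t -> 0 < y t -> 0 < z t ->
  0 <= g <= 1 -> 0 <= a <= 1 -> 0 <= b <= 1 ->
  is_derive t 1 (fun s => packed_angle (x s) (y s) (z s) g a b)
    (weight (x t) (y t) (z t) g a b * (eta - xi)
     + weight (z t) (x t) (y t) b g a * (zeta - xi)).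
Proof.
move=> hx hy hz x0 y0 z0 g01 a01 b01.
have dside (u v : R -> R) du dv c : is_derive t 1 u du -> is_derive t 1 v dv ->
    is_derive t 1 (fun s => sqr_length (u s) (v s) c)
      (2 * u t * du + 2 * v t * dv + 2 * c * (u t * dv + v t * du)).
  move=> hu hv.
  have -> : (fun s => sqr_length (u s) (v s) c) = u * u + v * v + (2 * c) \*: (u * v).
    by apply/funext => s; rewrite /sqr_length !fctE /= /GRing.scale/=; ring.
  by apply: is_derive_eq; rewrite /GRing.scale/=; ring.
have S1 := sqr_length_gt0 x0 y0 g01; have S2 := sqr_length_gt0 z0 x0 b01.
have D0 := area4_gt0 x0 y0 z0 g01 a01 b01.
have A0 : 0 < area16 (sqr_length (x t) (y t) g) (sqr_length (z t) (x t) b) (sqr_length (y t) (z t) a).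
  by rewrite area16_area4 mulr_gt0.
have H := is_derive_law_of_cosines (dside _ _ _ _ g hx hy) (dside _ _ _ _ b hz hx)
  (dside _ _ _ _ a hy hz) S1 S2 A0.
apply: (is_derive_eq H).
rewrite /weight area16_area4 -(area4_cycle (z t)) sqrtrM//.
have -> : Num.sqrt 4 = 2 :> R.
  by rewrite (_ : 4 = 2 ^+ 2) ?sqrtr_sqr ?ger0_norm//; ring.
have D1 : 0 < Num.sqrt (area4 (x t) (y t) (z t) g a b) by rewrite sqrtr_gt0.
rewrite /weight_num; move: S1 S2 D1; rewrite /sqr_length => S1 S2 D1.
by field; rewrite !gt_eqF.
Qed.

Lemma cos_in01 (Phi : R) : 0 <= Phi <= pi / 2 -> 0 <= cos Phi <= 1.
Proof.
move=> /andP[P0 P1]; rewrite cos_le1 andbT cos_ge0_pihalf// P1 andbT.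
by apply: le_trans P0; rewrite oppr_le0 divr_ge0// pi_ge0.
Qed.

(** The cosine exceeds - cos Phi because the sides from the corner are longer than y and z. *)
Lemma packed_angle_lt x y z g b Phi : 0 < x -> 0 < y -> 0 < z ->
  0 <= g <= 1 -> 0 <= Phi <= pi / 2 -> 0 <= b <= 1 ->
  packed_angle x y z g (cos Phi) b < pi - Phi.
Proof.
move=> x0 y0 z0 g01 Phi01 b01; have a01 := cos_in01 Phi01.
have t0 := packed_angle_gt0 x0 y0 z0 g01 a01 b01.
have t1 := packed_angle_ltpi x0 y0 z0 g01 a01 b01.
have pi0 := pi_gt0 R.
have [P0 P1] := andP Phi01.
rewrite -ltr_cos ?in_itv/=; [|by apply/andP; split; lra..].
rewrite addrC cosDpi cosN cos_packed_angle//.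
have S1 := sqr_length_gt0 x0 y0 g01; have S2 := sqr_length_gt0 z0 x0 b01.
rewrite ltr_pdivlMr ?mulr_gt0 ?sqrtr_gt0// mulNr /cos_num.
have [g0 _] := andP g01; have [b0 _] := andP b01; have [a0 _] := andP a01.
have yz : y * z <= Num.sqrt (sqr_length x y g) * Num.sqrt (sqr_length z x b).
  apply: ler_pM; rewrite ?(ltW y0) ?(ltW z0)//.
    rewrite -{1}[y]ger0_norm ?(ltW y0)// -sqrtr_sqr ler_sqrt ?(ltW S1)//.
    by apply: le_trans (sqr_length_ge_sumsqr x0 y0 g01); rewrite lerDr sqr_ge0.
  rewrite -{1}[z]ger0_norm ?(ltW z0)// -sqrtr_sqr ler_sqrt ?(ltW S2)//.
  by apply: le_trans (sqr_length_ge_sumsqr z0 x0 b01); rewrite lerDl sqr_ge0.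
have := ler_wpM2l a0 yz; have : 0 < x ^+ 2 by rewrite exprn_gt0.
have : 0 <= x * y * g by rewrite !mulr_ge0// ltW.
have : 0 <= x * z * b by rewrite !mulr_ge0// ltW.
lra.
Qed.

End PackedTriangle.

(** * Degenerating triangles *)

Section Degeneration.
Local Open Scope classical_set_scope.
Context {R : realType}.
Implicit Types (x y z g a b d : R).

Lemma sqr_length_le_small x y g d : 0 < x -> 0 < y -> 0 <= g <= 1 ->
  d <= 1 -> x <= d * y -> sqr_length x y g <= y ^+ 2 * (1 + 3 * d).
Proof.
move=> x0 y0 /andP[g0 g1] d1 xd.
have h1 : x * x <= d * y * y by rewrite ler_pM ?(ltW x0)// (le_trans xd)// ler_piMl// ltW.
have h2 : x * y * g <= d * y * y.
  apply: (@le_trans _ _ (x * y)); last by rewrite ler_wpM2r// ltW.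
  by rewrite ler_piMr// mulr_ge0// ltW.
by rewrite /sqr_length !expr2; lra.
Qed.

(** As x / y and x / z tend to 0 the sides from the corner tend to y and z, so the cosine of
the angle tends to - cos Phi, uniformly in the two other cosines. *)
Lemma packed_angle_vertex_shrinks (Phi eps : R) : 0 <= Phi <= pi / 2 -> 0 < eps ->
  exists2 d, 0 < d & forall x y z g b, 0 < x -> 0 < y -> 0 < z ->
    0 <= g <= 1 -> 0 <= b <= 1 -> x <= d * y -> x <= d * z ->
    pi - Phi - eps <= packed_angle x y z g (cos Phi) b.
Proof.
move=> Phi01 eps0; have a01 := cos_in01 Phi01.
have [P0 P1] := andP Phi01; have pi0 := pi_gt0 R.
have [s0|s0] := leP (pi - Phi - eps) 0.
  exists 1 => // x y z g b x0 y0 z0 g01 b01 _ _.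
  exact: le_trans s0 (ltW (packed_angle_gt0 _ _ _ _ _ _)).
set s := pi - Phi - eps in s0 *; set a := cos Phi in a01 *.
have eta0 : 0 < cos s + a.
  have -> : a = - cos (pi - Phi) by rewrite (addrC pi) cosDpi cosN opprK.
  have s1 : 0 <= s <= pi by apply/andP; split; rewrite /s in s0 *; lra.
  have s2 : 0 <= pi - Phi <= pi by apply/andP; split; lra.
  by rewrite subr_gt0 ltr_cos ?in_itv/=// /s; lra.
(* the estimate below is cos (angle) <= - a + 6 d, to be compared to cos s *)
pose d := (cos s + a) / 6; exists d; first by rewrite divr_gt0.
have [a0 a1] := andP a01.
have d0 : 0 < d by rewrite divr_gt0.
have d1 : d <= 1 by rewrite /d; have := cos_le1 s; lra.
move=> x y z g b x0 y0 z0 g01 b01 xy xz.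
have t0 := packed_angle_gt0 x0 y0 z0 g01 a01 b01.
have t1 := packed_angle_ltpi x0 y0 z0 g01 a01 b01.
rewrite leNgt; apply/negP => ts.
have : cos s < cos (packed_angle x y z g a b).
  have s1 : 0 <= s <= pi by apply/andP; split; rewrite /s in s0 *; lra.
  by rewrite ltr_cos ?in_itv/= ?s1 ?(ltW t0) ?(ltW t1).
apply/negP; rewrite -leNgt cos_packed_angle//.
have S1 := sqr_length_gt0 x0 y0 g01; have S2 := sqr_length_gt0 z0 x0 b01.
rewrite ler_pdivrMr ?mulr_gt0 ?sqrtr_gt0// -sqrtrM ?(ltW S1)//.
have yz0 : 0 < y * z by rewrite mulr_gt0.
have l_ge : y * z <= Num.sqrt (sqr_length x y g * sqr_length z x b).
  rewrite -{1}[y * z]ger0_norm ?(ltW yz0)// -sqrtr_sqr ler_sqrt ?mulr_ge0 ?(ltW S1) ?(ltW S2)//.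
  rewrite exprMn ler_pM ?sqr_ge0//.
    by apply: le_trans (sqr_length_ge_sumsqr x0 y0 g01); rewrite lerDr sqr_ge0.
  by apply: le_trans (sqr_length_ge_sumsqr z0 x0 b01); rewrite lerDl sqr_ge0.
have l_le : Num.sqrt (sqr_length x y g * sqr_length z x b) <= y * z * (1 + 3 * d).
  have dd : 0 < 1 + 3 * d by lra.
  have p0 : 0 < y * z * (1 + 3 * d) by rewrite mulr_gt0.
  rewrite -[leRHS]ger0_norm ?(ltW p0)// -sqrtr_sqr ler_sqrt ?sqr_ge0//.
  have -> : (y * z * (1 + 3 * d)) ^+ 2 = y ^+ 2 * (1 + 3 * d) * (z ^+ 2 * (1 + 3 * d)) by ring.
  rewrite ler_pM ?(ltW S1) ?(ltW S2)// ?sqr_length_le_small//.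
  by rewrite sqr_lengthC sqr_length_le_small.
set l := Num.sqrt _ in l_ge l_le *.
have cE : cos s = - a + 6 * d by rewrite /d; lra.
rewrite cE /cos_num.
have [[g0 g1] [b0 b1]] := (andP g01, andP b01).
have h1 : x * x <= d * (y * z).
  have : x * x <= d * y * z by rewrite ler_pM ?(ltW x0)// (le_trans xz)// ler_piMl// ltW.
  lra.
have h2 : x * y * g <= d * (y * z).
  apply: (@le_trans _ _ (x * y)); first by rewrite ler_piMr// mulr_ge0// ltW.
  by rewrite mulrCA mulrC ler_wpM2l// ltW.
have h3 : x * z * b <= d * (y * z).
  apply: (@le_trans _ _ (x * z)); first by rewrite ler_piMr// mulr_ge0// ltW.
  by rewrite mulrA ler_wpM2r// ltW.
have h4 : a * l <= a * (y * z * (1 + 3 * d)) by rewrite ler_wpM2l.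
have h5 : d * (y * z) <= d * l by rewrite ler_wpM2l// ltW.
have h6 : a * (d * (y * z)) <= d * (y * z) by rewrite ler_piMl// mulr_ge0// ltW.
rewrite expr2; lra.
Qed.

(** When the two other radii are negligible, the two sides from the corner are nearly equal
and the third one is negligible as well. *)
Lemma packed_angle_edge_shrinks (eps : R) : 0 < eps ->
  exists2 d, 0 < d & forall x y z g a b, 0 < x -> 0 < y -> 0 < z ->
    0 <= g <= 1 -> 0 <= a <= 1 -> 0 <= b <= 1 -> y <= d * x -> z <= d * x ->
    packed_angle x y z g a b <= eps.
Proof.
move=> eps0; have pi0 := pi_gt0 R.
have [s0|s0] := leP pi eps.
  exists 1 => // x y z g a b x0 y0 z0 g01 a01 b01 _ _.
  exact: le_trans (ltW (packed_angle_ltpi _ _ _ _ _ _)) s0.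
have c1 : cos eps < 1.
  by rewrite -cos0 ltr_cos ?in_itv/= ?lexx ?pi_ge0// (ltW eps0) ltW.
(* the estimate below is 1 - 4 d <= cos (angle), and 1 - 4 d >= cos eps *)
pose d := (1 - cos eps) / 8.
have d0 : 0 < d by rewrite divr_gt0// subr_gt0.
have d1 : d <= 1 / 4 by rewrite /d; have := cos_geN1 eps; lra.
exists d => // x y z g a b x0 y0 z0 g01 a01 b01 yx zx.
have t0 := packed_angle_gt0 x0 y0 z0 g01 a01 b01.
have t1 := packed_angle_ltpi x0 y0 z0 g01 a01 b01.
rewrite leNgt; apply/negP => ts.
have : cos (packed_angle x y z g a b) < cos eps.
  by rewrite ltr_cos ?in_itv/= ?(ltW eps0) ?(ltW s0) ?(ltW t0) ?(ltW t1).
apply/negP; rewrite -leNgt cos_packed_angle//.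
have S1 := sqr_length_gt0 x0 y0 g01; have S2 := sqr_length_gt0 z0 x0 b01.
rewrite ler_pdivlMr ?mulr_gt0 ?sqrtr_gt0// -sqrtrM ?(ltW S1)//.
have xx0 : 0 < x * x by rewrite mulr_gt0.
have l_le : Num.sqrt (sqr_length x y g * sqr_length z x b) <= x * x * (1 + 3 * d).
  have dd : 0 < 1 + 3 * d by lra.
  have p0 : 0 < x * x * (1 + 3 * d) by rewrite mulr_gt0.
  rewrite -[leRHS]ger0_norm ?(ltW p0)// -sqrtr_sqr ler_sqrt ?sqr_ge0//.
  have -> : (x * x * (1 + 3 * d)) ^+ 2 = x ^+ 2 * (1 + 3 * d) * (x ^+ 2 * (1 + 3 * d)) by ring.
  have d11 : d <= 1 by lra.
  rewrite ler_pM ?(ltW S1) ?(ltW S2)// ?sqr_length_le_small//.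
  by rewrite sqr_lengthC sqr_length_le_small.
set l := Num.sqrt _ in l_le *.
have [[[g0 g1] [a0 a1]] [b0 b1]] := (andP g01, andP a01, andP b01).
have h1 : cos eps * l <= (1 - 4 * d) * (x * x * (1 + 3 * d)).
  apply: (@le_trans _ _ ((1 - 4 * d) * l)).
    by rewrite ler_wpM2r ?sqrtr_ge0// /d; lra.
  by rewrite ler_wpM2l//; lra.
apply: le_trans h1 _.
have h2 : y * z * a <= d * (x * x).
  apply: (@le_trans _ _ (y * z)); first by rewrite ler_piMr// mulr_ge0// ltW.
  rewrite mulrA ler_pM ?(ltW y0) ?(ltW z0)//.
  by apply: le_trans zx _; rewrite ler_piMl ?(ltW x0)//; lra.
have h3 : 0 <= x * y * g by rewrite !mulr_ge0// ltW.
have h4 : 0 <= x * z * b by rewrite !mulr_ge0// ltW.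
have h5 : 0 <= d * d * (x * x) by rewrite !mulr_ge0// ltW.
have -> : (1 - 4 * d) * (x * x * (1 + 3 * d)) = x * x - d * (x * x) - 12 * (d * d * (x * x)) by ring.
rewrite /cos_num expr2; lra.
Qed.

End Degeneration.

(** * Flags of a cell division *)

Section Dihedral.
Variables (D : finType) (a b : D -> D).
Hypotheses (aK : involutive a) (bK : involutive b).
Hypotheses (a_neq : forall x, a x != x) (b_neq : forall x, b x != x).

Let rot x := b (a x).

Let rot_inj : injective rot.
Proof. by move=> x y E; apply: (can_inj aK); apply: (can_inj bK). Qed.

Let reflection_neq k y : a y != iter k rot y.
Proof.
elim/ltn_ind: k y => -[|[|k]] IH y //=; first by rewrite eq_sym b_neq.
apply/eqP => E; have := IH k (ltnW (ltnSn _)) (rot y); rewrite -iterSr iterS.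
by rewrite /rot in E *; rewrite E bK aK eqxx.
Qed.

(** Two fixed-point free involutions generate a dihedral action.  A reflection a y never lies
in the rotation orbit of y: peeling off one step at both ends would produce a fixed point
of a or of b.  So the orbit S consists of the rotation orbit of x and of its disjoint
image under a, and the rotation has order |S| / 2 on it. *)
Lemma dihedral_orbit (S : {set D}) (m : nat) (x : D) : #|S| = m.*2 ->
  (forall U : {set D}, x \in U -> (forall y, y \in U -> a y \in U) ->
     (forall y, y \in U -> b y \in U) -> S \subset U) ->
  x \in S -> (forall y, y \in S -> a y \in S) -> (forall y, y \in S -> b y \in S) ->
  iter m rot x = x /\
  forall y, y \in S -> (y \in traject rot x m) || (a y \in traject rot x m).
Proof.
move=> cardS minS xS aS bS.
pose O := [set y | fconnect rot x y]; pose n := fingraph.order rot x.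
have On i : iter i rot x \in O by rewrite inE fconnect_iter.
have OP y : reflect (exists i, y = iter i rot x) (y \in O).
  apply: (iffP idP) => [|[i ->]//]; rewrite inE => xy.
  by exists (findex rot x y); rewrite iter_findex.
have n_gt0 : (0 < n)%N by exact: order_gt0.
have itern : iter n rot x = x by apply: iter_order.
have itermul j : iter (j * n) rot x = x.
  by elim: j => // j IH; rewrite mulSn iterD IH.
have OaO : [disjoint O & [set a y | y in O]].
  rewrite -setI_eq0; apply/eqP/setP => y; rewrite !inE; apply/negP => /andP[].
  rewrite -/(fconnect rot x y) => /(iter_findex) Hy /imsetP[z /OP[i ->] Ey].
  set j := findex rot x y in Hy.
  have : iter (j + (i * n - i)) rot (iter i rot x) = iter j rot x.
    rewrite iterD -(iterD (i * n - i)%N) subnK ?leq_pmulr// itermul//.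
  by rewrite Hy Ey => /eqP; rewrite eq_sym (negPf (reflection_neq _ _)).
have cardO : #|O :|: [set a y | y in O]| = n.*2.
  rewrite cardsU (_ : O :&: _ = finset.set0) ?cards0 ?subn0; last first.
    by apply/eqP; rewrite setI_eq0.
  by rewrite card_imset ?addnn; [rewrite cardsE|exact: can_inj aK].
have SU : S = O :|: [set a y | y in O].
  apply/eqP; rewrite finset.eqEsubset; apply/andP; split.
    apply: minS.
    - by rewrite inE (On 0%N).
    - move=> y; rewrite !finset.in_setU => /orP[yO|/imsetP[z zO ->]].
        by rewrite imset_f ?orbT.
      by rewrite aK zO.
    - move=> y; rewrite !finset.in_setU => /orP[/OP[[|i] ->]|/imsetP[z /OP[i ->] ->]].
      + rewrite -[iter 0 rot x]/x -[x in b x]itern -(prednK n_gt0) iterS /rot bK -/rot.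
        by rewrite imset_f ?orbT.
      + by rewrite iterS /rot bK -/rot imset_f ?orbT.
      + by rewrite -[b _]/(iter i.+1 rot x) On.
  apply/fintype.subsetP => y; rewrite finset.in_setU.
  have OS z : z \in O -> z \in S.
    move=> /OP[i ->]; elim: i => // i IH; rewrite iterS /rot.
    by apply: bS; apply: aS.
  by move=> /orP[/OS//|/imsetP[z /OS zS ->]]; apply: aS.
have mn : m = n by apply: double_inj; rewrite -cardS -cardO SU.
split; first by rewrite mn.
have OT y : (y \in O) = (y \in traject rot x m).
  by rewrite inE fconnect_orbit mn.
move=> y; rewrite SU finset.in_setU OT => /orP[->//|/imsetP[z]].
by rewrite OT => zO ->; rewrite aK zO orbT.
Qed.

End Dihedral.

Section Flags.
Variable T : cell_division.
Implicit Types (x y z : flag T) (I : {set vertex T}).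

Lemma vtx_flip1 x : vtx (flip 1 x) = vtx x.
Proof. by apply/esym/vtxP; exists [:: 1]. Qed.
Lemma vtx_flip2 x : vtx (flip 2 x) = vtx x.
Proof. by apply/esym/vtxP; exists [:: 2]. Qed.
Lemma edg_flip0 x : edg (flip 0 x) = edg x.
Proof. by apply/esym/edgP; exists [:: 0]. Qed.
Lemma edg_flip2 x : edg (flip 2 x) = edg x.
Proof. by apply/esym/edgP; exists [:: 2]. Qed.
Lemma tri_flip0 x : tri (flip 0 x) = tri x.
Proof. by apply/esym/triP; exists [:: 0]. Qed.
Lemma tri_flip1 x : tri (flip 1 x) = tri x.
Proof. by apply/esym/triP; exists [:: 1]. Qed.

Lemma ord3_cases (k : 'I_3) : [\/ k = 0, k = 1 | k = 2].
Proof.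
case: k => -[|[|[|//]]] ?.
- by constructor 1; apply/val_inj.
- by constructor 2; apply/val_inj.
- by constructor 3; apply/val_inj.
Qed.

Lemma walk_closed (U : {set flag T}) (j : 'I_3) x w :
  (forall k y, k != j -> y \in U -> flip k y \in U) -> j \notin w ->
  x \in U -> walk (@flip T) x w \in U.
Proof.
move=> H; elim: w x => //= k w IH x; rewrite inE negb_or => /andP[jk jw] xU.
by apply: IH => //; apply: H => //; rewrite eq_sym.
Qed.

(** [flip 0] and [flip 1] generate a dihedral action of order 6 on the flags of a triangle,
in which [opp] is the rotation by one third. *)
Lemma triangle_flags x : opp (opp (opp x)) = x /\
  forall y, tri y = tri x ->
    [|| y == x, y == opp x, y == opp (opp x), flip 0 y == x, flip 0 y == opp x
      | flip 0 y == opp (opp x)].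
Proof.
have [|||||E H] := @dihedral_orbit _ (flip 0) (flip 1) (@flipK T 0) (@flipK T 1)
  (@flip_neq T 0) (@flip_neq T 1) [set y | tri y == tri x] 3 x.
- by rewrite card_tri.
- move=> U xU aU bU; apply/fintype.subsetP => y; rewrite inE => /eqP/esym/triP[w w2 <-].
  apply: walk_closed w2 xU => k z; case: (ord3_cases k) => -> // _; [exact: aU|exact: bU].
- by rewrite inE.
- by move=> y; rewrite !inE tri_flip0.
- by move=> y; rewrite !inE tri_flip1.
split; first exact: E.
by move=> y yx; have := H y; rewrite !inE yx eqxx => /(_ isT); rewrite -!orbA.
Qed.

(** The four flags of an edge: [flip 0] and [flip 2] commute. *)
Lemma edge_flags x : flip 0 (flip 2 (flip 0 x)) = flip 2 x /\
  forall y, edg y = edg x ->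
  [|| y == x, y == flip 2 (flip 0 x), flip 0 y == x | flip 0 y == flip 2 (flip 0 x)].
Proof.
have [|||||E H] := @dihedral_orbit _ (flip 0) (flip 2) (@flipK T 0) (@flipK T 2)
  (@flip_neq T 0) (@flip_neq T 2) [set y | edg y == edg x] 2 x.
- by rewrite card_edg.
- move=> U xU aU bU; apply/fintype.subsetP => z; rewrite inE => /eqP/esym/edgP[w w2 <-].
  apply: walk_closed w2 xU => k u; case: (ord3_cases k) => -> // _; [exact: aU|exact: bU].
- by rewrite inE.
- by move=> z; rewrite !inE edg_flip0.
- by move=> z; rewrite !inE edg_flip2.
split; first by move: E => /= E; rewrite -[in RHS]E flipK.
by move=> y yx; have := H y; rewrite !inE yx eqxx => /(_ isT); rewrite -!orbA.
Qed.

Lemma oppK3 x : opp (opp (opp x)) = x. Proof. by case: (triangle_flags x). Qed.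

Lemma opp_inj : injective (@opp T).
Proof. by apply: (can_inj (g := fun x => opp (opp x))) => x; exact: oppK3. Qed.

Lemma flip0_flip1 x : flip 0 (flip 1 x) = opp (opp x).
Proof. by apply: opp_inj; rewrite oppK3 /opp !flipK. Qed.

Lemma vtx_opp x : vtx (opp x) = vtx (flip 0 x).
Proof. by rewrite /opp vtx_flip1. Qed.

Lemma tri_opp x : tri (opp x) = tri x.
Proof. by rewrite /opp tri_flip1 tri_flip0. Qed.

Lemma edg_flip1 x : edg (flip 1 x) = edg (opp (opp x)).
Proof. by rewrite -flip0_flip1 edg_flip0. Qed.

Lemma edge_vertices_flag x : edge_vertices (edg x) = [set vtx x; vtx (opp x)].
Proof.
have [E H] := edge_flags x; rewrite vtx_opp.
apply/setP => v; rewrite !inE; apply/imsetP/idP => [[y]|].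
  rewrite inE => /eqP /H /or4P[] /eqP Ey ->.
  - by rewrite Ey eqxx.
  - by rewrite Ey vtx_flip2 eqxx orbT.
  - by rewrite -Ey flipK eqxx orbT.
  - by rewrite -[y](flipK 0) Ey E vtx_flip2 eqxx.
case/orP => /eqP ->; first by exists x; rewrite ?inE.
by exists (flip 0 x); rewrite // inE edg_flip0.
Qed.

Lemma triangle_vertices_flag x :
  triangle_vertices (tri x) = [set vtx x; vtx (opp x); vtx (opp (opp x))].
Proof.
have [_ H] := triangle_flags x.
have v0 y z : flip 0 y = z -> vtx y = vtx (opp z) by move=> <-; rewrite vtx_opp flipK.
apply/setP => v; rewrite !inE; apply/imsetP/idP => [[y]|].
  rewrite inE => /eqP /H; rewrite -!orbA.
  do 3![case/orP => [/eqP -> ->|]; first by rewrite eqxx ?orbT].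
  case/or3P => /eqP /v0 -> ->; rewrite ?oppK3 eqxx ?orbT//.
rewrite -orbA => /or3P[] /eqP ->; first by exists x; rewrite ?inE.
  by exists (opp x); rewrite // inE tri_opp.
by exists (opp (opp x)); rewrite // inE !tri_opp.
Qed.

Definition only_corner I x := [&& vtx x \in I, vtx (opp x) \notin I & vtx (opp (opp x)) \notin I].

Lemma only_corner_disjoint I x :
  (vtx x \in I) && [disjoint edge_vertices (edg (opp x)) & I] = only_corner I x.
Proof.
rewrite edge_vertices_flag /only_corner; congr andb.
by rewrite finset.disjoints_subset finset.subUset !finset.sub1set !finset.in_setC.
Qed.

(** This is where the connectedness of the surface enters: a walk from I to its complement
leaves I across some [flip 0]. *)
Lemma boundary_flag I : I != finset.set0 -> I != finset.setT ->
  exists x, (vtx x \in I) && (vtx (opp x) \notin I).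
Proof.
move=> /set0Pn[i iI]; rewrite -finset.subTset => /subsetPn[j _ jI].
have [x xi] := vtx_surj i; have [y yj] := vtx_surj j.
have [w wE] := flag_connected x y.
have : vtx x \in I by rewrite xi.
have : vtx (walk (@flip T) x w) \notin I by rewrite wE yj.
elim: w x {xi wE} => [|k w IH] x /=; first by move=> /negPf ->.
move=> H xI; have [fI|fI] := boolP (vtx (flip k x) \in I); first exact: (IH _ H fI).
case: (ord3_cases k) fI => ->; rewrite ?vtx_flip1 ?vtx_flip2 ?xI// => fI.
by exists x; rewrite xI vtx_opp.
Qed.

Section Counting.
Variable R : realType.
Implicit Types (G : flag T -> R).

Lemma sum_opp G : \sum_x G (opp x) = \sum_x G x.
Proof. by rewrite [RHS](reindex_inj opp_inj). Qed.

(** A sum over flags can be read triangle by triangle. *)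
Lemma sum_triangle_average G :
  \sum_x G x = (\sum_x (G x + G (opp x) + G (opp (opp x)))) / 3.
Proof.
rewrite !big_split/= (sum_opp (fun x => G (opp x))) sum_opp.
by field.
Qed.

Lemma sum_vertex_flags (P : pred (vertex T)) G :
  \sum_(i | P i) \sum_(x | vtx x == i) G x = \sum_(x | P (vtx x)) G x.
Proof.
rewrite (partition_big (@vtx T) P)//=; apply: eq_bigr => i Pi.
by apply: eq_bigl => x; case: eqP => [->|]; rewrite ?Pi// andbF.
Qed.

Lemma card_edges_flags (P : pred (edge T)) :
  4 * #|[set e | P e]|%:R = \sum_(x | P (edg x)) 1 :> R.
Proof.
rewrite (partition_big (@edg T) P)//=.
rewrite -sum1_card natr_sum mulr_sumr.
apply: eq_big => [e|e]; rewrite finset.in_set// => Pe; rewrite mulr1 -(card_edg e) -sum1_card natr_sum.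
by apply: eq_big => // x; rewrite inE; case: eqP => [->|]; rewrite ?Pe ?andbF.
Qed.

Lemma card_triangles_flags (P : pred (triangle T)) :
  6 * #|[set t | P t]|%:R = \sum_(x | P (tri x)) 1 :> R.
Proof.
rewrite (partition_big (@tri T) P)//=.
rewrite -sum1_card natr_sum mulr_sumr.
apply: eq_big => [e|e]; rewrite finset.in_set// => Pe; rewrite mulr1 -(card_tri e) -sum1_card natr_sum.
by apply: eq_big => // x; rewrite inE; case: eqP => [->|]; rewrite ?Pe ?andbF.
Qed.

(** The triple recorded in [Lk] by a flag x determines its corner, to which exactly the two
flags x and [flip 1 x] belong. *)
Lemma sum_Lk_flags I (F : edge T -> R) :
  2 * \sum_(p in Lk I) F p.1.1 = \sum_(x | only_corner I x) F (edg (opp x)).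
Proof.
pose p x := (edg (opp x), vtx x, tri x).
have pLk x : only_corner I x -> p x \in Lk I.
  by move=> Ix; apply: imset_f; rewrite inE only_corner_disjoint.
rewrite (partition_big p (mem (Lk I)) pLk)/= mulr_sumr.
apply: eq_bigr => q /imsetP[x]; rewrite inE only_corner_disjoint => Ix ->.
have o1 : opp (flip 1 x) = flip 1 (opp (opp x)).
  by rewrite -flip0_flip1.
have o2 : opp (opp (flip 1 x)) = flip 0 x.
  by rewrite o1 -[LHS]/(flip 1 (flip 0 (flip 1 (opp (opp x))))) flip0_flip1 oppK3 /opp flipK.
have f1 : only_corner I (flip 1 x).
  by move: Ix; rewrite /only_corner o2 o1 !vtx_flip1 -vtx_opp => /and3P[-> -> ->].
have e1 : edg (opp (flip 1 x)) = edg (opp x) by rewrite o1 edg_flip1 oppK3.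
have pf1 : p (flip 1 x) = p x by rewrite /p e1 vtx_flip1 tri_flip1.
rewrite (bigD1 x) ?Ix ?eqxx//= (bigD1 (flip 1 x)) ?f1 ?pf1 ?eqxx ?flip_neq//=.
rewrite big1 ?addr0; last first.
  move=> y /andP[/andP[/andP[Iy /eqP [_ yv yt]] yx] yf]; exfalso.
  have [_ /(_ y yt)] := triangle_flags x; rewrite (negPf yx) /=.
  have v0 u z : flip 0 u = z -> vtx u = vtx (opp z) by move=> <-; rewrite vtx_opp flipK.
  case/and3P: Ix => x0 x1 x2; case/and3P: Iy => y0 _ _.
  case/or4P => [/eqP E|/eqP E|/eqP/v0 E|/orP[/eqP/v0 E|/eqP E]].
  - by rewrite -E y0 in x1.
  - by rewrite -E y0 in x2.
  - by rewrite -E y0 in x1.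
  - by rewrite -E y0 in x2.
  - by move: yf; rewrite -[y](flipK 0) E -flip0_flip1 flipK eqxx.
by rewrite e1 /p/=; ring.
Qed.

End Counting.

End Flags.

(** * Summation over flags and the curvature of subsets *)

Section FlagSums.
Variables (R : realType) (T : cell_division).
Implicit Types (x y : flag T) (I : {set vertex T}) (f : vertex T -> R).

Lemma vertices_gt0 : (0 < #|vertex T|)%N.
Proof.
have /card_gt0P[x _] := flag_nonempty T.
by apply/card_gt0P; exists (vtx x).
Qed.

Lemma euler_flags :
  (euler T)%:~R = #|vertex T|%:R - #|flag T|%:R / 12 :> R.
Proof.
have := card_edges_flags R (fun _ : edge T => true).
have := card_triangles_flags R (fun _ : triangle T => true).
rewrite (sumr_const (flag T) 1) => E6 E4.
rewrite /euler rmorphD rmorphB/=.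
have -> : #|edge T|%:~R = #|flag T|%:R / 4 :> R.
  by rewrite -E4 -cardsT (_ : [set e | true] = [set: edge T])//; field.
have -> : #|triangle T|%:~R = #|flag T|%:R / 6 :> R.
  by rewrite -E6 -cardsT (_ : [set e | true] = [set: triangle T])//; field.
rewrite -pmulrn; lra.
Qed.

Lemma euler_sub_flags I :
  (euler_sub I)%:~R = #|I|%:R
    - (\sum_x ((vtx x \in I) && (vtx (opp x) \in I))%:R) / 4
    + (\sum_x [&& vtx x \in I, vtx (opp x) \in I & vtx (opp (opp x)) \in I]%:R) / 6 :> R.
Proof.
have := card_edges_flags R (fun e => edge_vertices e \subset I).
have := card_triangles_flags R (fun t => triangle_vertices t \subset I).
rewrite [X in _ = X -> _]big_mkcond [X in _ -> _ = X -> _]big_mkcond /=.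
under eq_bigr => x _.
  rewrite triangle_vertices_flag !finset.subUset !finset.sub1set -andbA.
  rewrite (_ : (if _ then 1 else 0) =
    ([&& vtx x \in I, vtx (opp x) \in I & vtx (opp (opp x)) \in I]%:R : R)); last by case: ifP.
  over.
move=> E6.
under eq_bigr => x _.
  rewrite edge_vertices_flag !finset.subUset !finset.sub1set.
  rewrite (_ : (if _ then 1 else 0) = (((vtx x \in I) && (vtx (opp x) \in I))%:R : R)); last by case: ifP.
  over.
move=> E4; rewrite /euler_sub rmorphD rmorphB/= -!pmulrn -E4 -E6.
by field.
Qed.

(** Only the steps [flip 0] change the vertex, and each of them costs one term of the sum. *)
Lemma dirichlet_path x w : exists2 C : R, 0 <= C & forall f,
  (f (vtx x) - f (vtx (walk (@flip T) x w))) ^+ 2 <=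
  C * \sum_z (f (vtx z) - f (vtx (opp z))) ^+ 2.
Proof.
elim: w x => [|k w IH] x /=.
  by exists 0 => // f; rewrite subrr expr0n mul0r.
have [C C0 HC] := IH (flip k x); exists (2 + 2 * C); first lra.
move=> f; have {HC} := HC f; set E := \sum_z _.
set c := f (vtx (walk _ _ _)) => HC.
have step : (f (vtx x) - f (vtx (flip k x))) ^+ 2 <= E.
  have E0 : 0 <= E by apply: sumr_ge0 => z _; exact: sqr_ge0.
  case: (ord3_cases k) => ->; rewrite ?vtx_flip1 ?vtx_flip2 ?subrr ?expr0n//.
  rewrite -vtx_opp /E (bigD1 x)//= lerDl.
  by apply: sumr_ge0 => z _; exact: sqr_ge0.
have := sqr_ge0 ((f (vtx x) - f (vtx (flip k x))) - (f (vtx (flip k x)) - c)).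
move: HC step; rewrite !expr2; lra.
Qed.

(** If the f_i add up to 0, then f_i f_j <= 0 for some j, so f_i^2 is at most
(f_i - f_j)^2, which a path of flags from i to j bounds. *)
Lemma poincare : exists2 C : R, 0 < C & forall f, \sum_i f i = 0 ->
  \sum_i f i ^+ 2 <= C * \sum_x (f (vtx x) - f (vtx (opp x))) ^+ 2.
Proof.
have H (p : vertex T * vertex T) : exists C : R, 0 <= C /\ forall f,
    (f p.1 - f p.2) ^+ 2 <= C * \sum_x (f (vtx x) - f (vtx (opp x))) ^+ 2.
  have [x xi] := vtx_surj p.1; have [y yj] := vtx_surj p.2.
  have [w wE] := flag_connected x y.
  by have [C C0 HC] := dirichlet_path x w; exists C; split=> // f; rewrite -xi -yj -wE.
have [C CP] := choice H.
pose B := \sum_p C p + 1.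
have B0 : 0 < B by rewrite ltr_wpDl// sumr_ge0// => p _; case: (CP p).
exists (#|vertex T|%:R * B); first by rewrite mulr_gt0// ltr0n vertices_gt0.
move=> f f0; set E := (X in _ <= _ * X).
have E0 : 0 <= E by apply: sumr_ge0 => z _; exact: sqr_ge0.
have Hi i : f i ^+ 2 <= B * E.
  have [j fij] : exists j, f i * f j <= 0.
    apply: contrapT => /forallNP Hj.
    have Hj' j : 0 < f i * f j by rewrite ltNge; apply/negP; exact: Hj.
    have : 0 < \sum_j f i * f j.
      rewrite (bigD1 i)//= ltr_pwDl// sumr_ge0// => j _; exact: ltW.
    by rewrite -mulr_sumr f0 mulr0 ltxx.
  have [C0 HC] := CP (i, j).
  apply: (@le_trans _ _ ((f i - f j) ^+ 2)).
    by have := sqr_ge0 (f j); rewrite !expr2; lra.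
  have HE : (f i - f j) ^+ 2 <= C (i, j) * E := HC f.
  apply: (le_trans HE); apply: ler_wpM2r => //.
  rewrite /B (bigD1 (i, j))//= -addrA lerDl addr_ge0// sumr_ge0// => p _.
  by case: (CP p).
apply: le_trans (ler_sum _ (fun i _ => Hi i)) _.
by rewrite sumr_const -[leLHS]mulr_natl mulrA.
Qed.

End FlagSums.

Section Curvature.
Variables (R : realType) (T : cell_division) (Phi : edge T -> R).
Hypothesis Phi_range : forall e, 0 <= Phi e <= pi / 2.
Implicit Types (x y : flag T) (i : vertex T) (I : {set vertex T}) (r : vertex T -> R).

Definition flag_cos x := cos (Phi (edg x)).

Lemma flag_cos01 x : 0 <= flag_cos x <= 1. Proof. exact: cos_in01. Qed.

Definition flag_weight r x : R :=
  weight (r (vtx x)) (r (vtx (opp x))) (r (vtx (opp (opp x))))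
    (flag_cos x) (flag_cos (opp x)) (flag_cos (opp (opp x))).

Lemma sqr_length_ge0 (x y g : R) : 0 <= g <= 1 -> 0 <= sqr_length x y g.
Proof.
move=> /andP[g0 g1].
have -> : sqr_length x y g = g * (x + y) ^+ 2 + (1 - g) * (x ^+ 2 + y ^+ 2).
  by rewrite /sqr_length; ring.
by apply: addr_ge0; apply: mulr_ge0; rewrite ?sqr_ge0 ?subr_ge0 ?addr_ge0 ?sqr_ge0.
Qed.

(** The flags x, [opp x], [opp (opp x)] represent the corners of the triangle in cyclic
order, and their edges are the sides that join each corner to the next. *)
Lemma inner_angleE r x : inner_angle Phi r x =
  packed_angle (r (vtx x)) (r (vtx (opp x))) (r (vtx (opp (opp x))))
    (flag_cos x) (flag_cos (opp x)) (flag_cos (opp (opp x))).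
Proof.
have LE y : edge_length Phi r y = Num.sqrt (sqr_length (r (vtx y)) (r (vtx (opp y))) (flag_cos y)).
  by rewrite vtx_opp.
have L1 : edge_length Phi r (flip 1 x) =
    Num.sqrt (sqr_length (r (vtx (opp (opp x)))) (r (vtx x)) (flag_cos (opp (opp x)))).
  by rewrite /edge_length vtx_flip1 flip0_flip1 edg_flip1 sqr_lengthC.
rewrite /inner_angle L1 !LE !sqr_sqrtr ?sqr_length_ge0 ?flag_cos01//.
Qed.

Lemma inner_angle_sum r x : (forall i, 0 < r i) ->
  inner_angle Phi r x + inner_angle Phi r (opp x) + inner_angle Phi r (opp (opp x)) = pi.
Proof.
by move=> r0; rewrite !inner_angleE !oppK3 packed_angle_sum ?flag_cos01.
Qed.

Lemma inner_angle_gt0 r x : (forall i, 0 < r i) -> 0 < inner_angle Phi r x.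
Proof. by move=> r0; rewrite inner_angleE packed_angle_gt0 ?flag_cos01. Qed.

Lemma inner_angle_lt r x : (forall i, 0 < r i) ->
  inner_angle Phi r x < pi - Phi (edg (opp x)).
Proof. by move=> r0; rewrite inner_angleE packed_angle_lt ?flag_cos01. Qed.

Lemma curvature_sum r (P : pred (vertex T)) :
  \sum_(i | P i) curvature Phi r i =
  2 * pi * #|P|%:R - (\sum_(x | P (vtx x)) inner_angle Phi r x) / 2.
Proof.
rewrite /curvature big_split/= sumr_const; congr (_ + _); first by rewrite mulr_natr.
by rewrite sumrN /cone_angle -mulr_suml sum_vertex_flags.
Qed.

Definition mean_curvature : R := 2 * pi * (euler T)%:~R / #|vertex T|%:R.

(** With the angle sum pi in each triangle, the total curvature is a count of cells. *)
Lemma gauss_bonnet r : (forall i, 0 < r i) -> curvature_avg Phi r = mean_curvature.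
Proof.
move=> r0; rewrite /curvature_avg (curvature_sum r xpredT)/= sum_triangle_average.
under eq_bigr do rewrite inner_angle_sum//.
rewrite sumr_const /mean_curvature euler_flags -mulr_natr; congr (_ / _).
by rewrite (_ : #|xpredT| = #|vertex T|)//; field.
Qed.

(** Share of the flag x in [angle_gap].  The three terms match, flag by flag, the sum over
[Lk], the edges inside I and the angles at I. *)
Definition flag_gap r I x : R :=
  (only_corner I x)%:R * (pi - Phi (edg (opp x)))
  + pi * ((vtx x \in I) && (vtx (opp x) \in I))%:R
  - (vtx x \in I)%:R * inner_angle Phi r x.

(** The amount by which the angles at the corners in I of the triangle of x fall short of
their values for infinitesimal radii in I: these are 0 or pi in total if I contains none
or all of the corners, pi if it contains two of them, and pi - Phi(e) for a single corner
opposite to e. *)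
Definition angle_gap r I x : R :=
  flag_gap r I x + flag_gap r I (opp x) + flag_gap r I (opp (opp x))
  - 2 * pi * [&& vtx x \in I, vtx (opp x) \in I & vtx (opp (opp x)) \in I]%:R.

(** The limit of the sum of the K_i over I when the radii in I become infinitesimal. *)
Definition limit_curvature I : R :=
  - (\sum_(p in Lk I) (pi - Phi p.1.1)) + 2 * pi * (euler_sub I)%:~R.

(** Each edge has four flags, each triangle six, and each element of [Lk] two; these
multiplicities turn the Euler characteristic of F_I and the sum over [Lk] into sums over
flags. *)
Lemma curvature_sub r I :
  \sum_(i in I) curvature Phi r i =
  limit_curvature I + (\sum_x angle_gap r I x) / 6.
Proof.
rewrite (curvature_sum r (mem I)) /limit_curvature euler_sub_flags.
have -> : \sum_(p in Lk I) (pi - Phi p.1.1) =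
    (\sum_x (only_corner I x)%:R * (pi - Phi (edg (opp x)))) / 2.
  apply: (@mulfI _ 2) => //; rewrite (sum_Lk_flags I (fun e => pi - Phi e)).
  rewrite mulrCA mulfV// mulr1 big_mkcond; apply: eq_bigr => x _.
  by case: ifP; rewrite ?mul1r ?mul0r.
rewrite [\sum_(x | mem I _) _]big_mkcond/=.
have -> : \sum_x (if vtx x \in I then inner_angle Phi r x else 0) =
    \sum_x (vtx x \in I)%:R * inner_angle Phi r x.
  by apply: eq_bigr => x _; case: ifP; rewrite ?mul1r ?mul0r.
have -> : \sum_x angle_gap r I x = 3 * (\sum_x flag_gap r I x) -
    2 * pi * (\sum_x [&& vtx x \in I, vtx (opp x) \in I & vtx (opp (opp x)) \in I]%:R).
  by rewrite [\sum_x flag_gap r I x]sum_triangle_average mulrCA mulfV// mulr1 sumrB -mulr_sumr.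
rewrite /flag_gap sumrB big_split/= -mulr_sumr.
by field.
Qed.

(** According to the number 0, 1, 2, 3 of corners in I, the gap is 0, then pi - Phi(e) minus
the angle opposite to e, then the third angle, then 0. *)
Lemma angle_gap_ge0 r I x : (forall i, 0 < r i) -> 0 <= angle_gap r I x.
Proof.
move=> r0; rewrite /angle_gap /flag_gap /only_corner !oppK3.
have := inner_angle_sum x r0.
have := inner_angle_gt0 x r0; have := inner_angle_gt0 (opp x) r0.
have := inner_angle_gt0 (opp (opp x)) r0.
have := inner_angle_lt x r0; have := inner_angle_lt (opp x) r0.
have := inner_angle_lt (opp (opp x)) r0; rewrite oppK3.
by case: (vtx x \in I); case: (vtx (opp x) \in I);
  case: (vtx (opp (opp x)) \in I) => /=; lra.
Qed.

Lemma angle_gap_gt0 r I x : (forall i, 0 < r i) ->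
  vtx x \in I -> vtx (opp x) \notin I -> 0 < angle_gap r I x.
Proof.
move=> r0; rewrite /angle_gap /flag_gap /only_corner !oppK3 => -> /negPf ->.
have := inner_angle_sum x r0.
have := inner_angle_gt0 x r0; have := inner_angle_gt0 (opp x) r0.
have := inner_angle_gt0 (opp (opp x)) r0.
have := inner_angle_lt x r0; have := inner_angle_lt (opp x) r0.
have := inner_angle_lt (opp (opp x)) r0; rewrite oppK3.
by case: (vtx (opp (opp x)) \in I) => /=; lra.
Qed.

Lemma limit_curvature_lt r I : (forall i, 0 < r i) ->
  I != finset.set0 -> I != finset.setT ->
  limit_curvature I < \sum_(i in I) curvature Phi r i.
Proof.
move=> r0 I0 IT; rewrite curvature_sub ltrDl divr_gt0//.
have [x /andP[xI oI]] := boundary_flag I0 IT.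
rewrite (bigD1 x)//= ltr_pwDl ?angle_gap_gt0//.
by apply: sumr_ge0 => y _; exact: angle_gap_ge0.
Qed.

End Curvature.

(** * Curvature in logarithmic coordinates *)

Section LogLipschitz.
Local Open Scope classical_set_scope.
Variables (R : realType) (T : cell_division) (Phi : edge T -> R).
Hypothesis Phi_range : forall e, 0 <= Phi e <= pi / 2.
Implicit Types (x y : flag T) (i : vertex T) (I : {set vertex T}) (r : vertex T -> R).

Lemma is_derive_inner_angle (r : R -> vertex T -> R) (t : R) (v : vertex T -> R) x :
  (forall i, 0 < r t i) -> (forall i, is_derive t 1 (r^~ i) (r t i * v i)) ->
  is_derive t 1 (fun s => inner_angle Phi (r s) x)
    (flag_weight Phi (r t) x * (v (vtx (opp x)) - v (vtx x))
     + flag_weight Phi (r t) (opp (opp x)) * (v (vtx (opp (opp x))) - v (vtx x))).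
Proof.
move=> r0 rd; under eq_fun do rewrite inner_angleE//.
rewrite /flag_weight !oppK3.
by apply: is_derive_packed_angle; rewrite ?flag_cos01.
Qed.

Lemma is_derive_curvature (r : R -> vertex T -> R) (t : R) (v : vertex T -> R) i :
  (forall i, 0 < r t i) -> (forall i, is_derive t 1 (r^~ i) (r t i * v i)) ->
  is_derive t 1 (fun s => curvature Phi (r s) i)
    (- (\sum_(x | vtx x == i)
      (flag_weight Phi (r t) x * (v (vtx (opp x)) - v (vtx x))
     + flag_weight Phi (r t) (opp (opp x)) * (v (vtx (opp (opp x))) - v (vtx x)))) / 2).
Proof.
move=> r0 rd.
have H := @is_derive_bigsum R _ (index_enum (flag T)) (fun x => vtx x == i) _ _ t
  (fun x => is_derive_inner_angle x r0 rd).
have -> : (fun s => curvature Phi (r s) i) =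
   cst (2 * pi) - 2^-1 \*: (fun s => \sum_(x | vtx x == i) inner_angle Phi (r s) x).
  apply/funext => s; rewrite /curvature /cone_angle !fctE /= /GRing.scale/=.
  by congr (_ - _); exact: mulrC.
by apply: is_derive_eq; rewrite sub0r mulNr mulrC.
Qed.

Definition lipschitz_const : R := 6 * #|flag T|%:R.

Lemma lipschitz_const_gt0 : 0 < lipschitz_const.
Proof. by rewrite mulr_gt0// ltr0n flag_nonempty. Qed.

Lemma flag_weight_bound r x : (forall i, 0 < r i) -> `|flag_weight Phi r x| <= 3.
Proof.
move=> r0; rewrite ger0_norm; first by rewrite weight_le3 ?flag_cos01.
by rewrite weight_ge0 ?flag_cos01.
Qed.

(** Mean value theorem along the segment from v to u, with the bound 3 for the weights. *)
Lemma curvature_exp_lipschitz (u v : vertex T -> R) (c : R) i :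
  (forall j, `|u j - v j| <= c) ->
  `|curvature Phi (expR \o u) i - curvature Phi (expR \o v) i| <= lipschitz_const * c.
Proof.
move=> uv.
have c0 : 0 <= c by apply: le_trans (uv i).
pose r (s : R) j := expR (v j + s * (u j - v j)).
have r_gt0 s j : 0 < r s j by apply: expR_gt0.
have rd (s : R) j : is_derive s 1 (r^~ j) (r s j * (u j - v j)).
  have h : is_derive s 1 (cst (v j) + (u j - v j) \*: id) (u j - v j).
    by apply: is_derive_eq; rewrite add0r /GRing.scale/= mulr1.
  have -> : r^~ j = expR \o (cst (v j) + (u j - v j) \*: id).
    by apply/funext => z; rewrite /r /= !fctE /= /GRing.scale/= mulrC.
  rewrite (_ : r s j = expR ((cst (v j) + (u j - v j) \*: id) s)).
    exact: is_derive1_comp.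
  by rewrite /r !fctE /= /GRing.scale/= mulrC.
have Kd s := is_derive_curvature i (r_gt0 s) (rd s).
have [|s _ E] := @right_MVT R (fun s => curvature Phi (r s) i) _ 0 1 ltr01 _ (fun s _ => Kd s).
  by apply: cvg_at_right_filter; apply: is_derive_continuous (Kd 0).
have r1 : r 1 = expR \o u by apply/funext => j; rewrite /r mul1r addrC subrK.
have r0 : r 0 = expR \o v by apply/funext => j; rewrite /r mul0r addr0.
rewrite -r1 -r0 E subr0 mulr1 normrM normrN normfV (@ger0_norm _ 2)//.
rewrite ler_pdivrMr//.
have uv2 j k : `|u j - v j - (u k - v k)| <= c + c.
  by apply: le_trans (ler_normB _ _) _; apply: lerD.
have key : `|\sum_(x | vtx x == i)
   (flag_weight Phi (r s) x * (u (vtx (opp x)) - v (vtx (opp x)) - (u (vtx x) - v (vtx x)))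
   + flag_weight Phi (r s) (opp (opp x)) *
     (u (vtx (opp (opp x))) - v (vtx (opp (opp x))) - (u (vtx x) - v (vtx x))))|
   <= \sum_(x : flag T) 12 * c.
  apply: le_trans (ler_norm_sum _ _ _) _; rewrite big_mkcond/=.
  apply: ler_sum => x _; case: ifP => _; last by rewrite mulr_ge0.
  apply: le_trans (ler_normD _ _) _.
  have -> : 12 * c = 3 * (c + c) + 3 * (c + c) by ring.
  by apply: lerD; rewrite normrM; apply: ler_pM => //; exact: flag_weight_bound.
apply: le_trans key _; rewrite sumr_const -mulr_natr /lipschitz_const.
by rewrite le_eqVlt; apply/orP; left; apply/eqP; ring.
Qed.

Lemma curvature_lipschitz r r' (c : R) i : (forall j, 0 < r j) -> (forall j, 0 < r' j) ->
  (forall j, `|ln (r j) - ln (r' j)| <= c) ->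
  `|curvature Phi r i - curvature Phi r' i| <= lipschitz_const * c.
Proof.
move=> r0 r'0 H.
have E (s : vertex T -> R) : (forall j, 0 < s j) -> s = expR \o (fun j => ln (s j)).
  by move=> s0; apply/funext => j /=; rewrite lnK ?posrE.
by rewrite (E r r0) (E r' r'0); apply: curvature_exp_lipschitz.
Qed.

Lemma curvature_cvg (U : Type) (F : set_system U) (r : U -> vertex T -> R) r' i :
  Filter F ->
  (\forall u \near F, forall j, 0 < r u j) -> (forall j, 0 < r' j) ->
  (forall j, r u j @[u --> F] --> r' j) ->
  curvature Phi (r u) i @[u --> F] --> curvature Phi r' i.
Proof.
move=> FF r0 r'0 H; apply/cvgrPdist_le => e e0.
have L0 := lipschitz_const_gt0.
have Hl : \forall u \near F, forall j, `|ln (r' j) - ln (r u j)| <= e / lipschitz_const.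
  apply: (@filter_forall _ _ (fun j u => is_true (`|ln (r' j) - ln (r u j)| <= _)) F _) => j.
  have : ln (r u j) @[u --> F] --> ln (r' j).
    exact: (continuous_cvg _ (continuous_ln (r'0 j)) (H j)).
  by move/cvgrPdist_le; apply; rewrite divr_gt0.
apply: filterS2 r0 Hl => u ru Hu.
by have := curvature_lipschitz i r'0 ru Hu; rewrite mulrCA mulfV ?mulr1 ?gt_eqF.
Qed.

(** In logarithmic coordinates the vector field is globally Lipschitz. *)
Theorem ricci_flow_exists (r0 : vertex T -> R) : (forall i, 0 < r0 i) ->
  exists r : R -> vertex T -> R, ricci_flow Phi r0 r.
Proof.
move=> r0_gt0.
pose F u i := mean_curvature R T - curvature Phi (expR \o u) i.
have FL (u v : vertex T -> R) c i : (forall j, `|u j - v j| <= c) ->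
    `|F u i - F v i| <= lipschitz_const * c.
  move=> uv; have -> : F u i - F v i =
      - (curvature Phi (expR \o u) i - curvature Phi (expR \o v) i) by rewrite /F; ring.
  by rewrite normrN; apply: curvature_exp_lipschitz.
have [u [u0 ud]] := ode_global_solution lipschitz_const_gt0 FL (fun i => ln (r0 i)).
pose r t i := expR (u t i).
have rd (t : R) i : 0 <= t -> is_derive t 1 (r^~ i)
    (- (curvature Phi (r t) i - curvature_avg Phi (r t)) * r t i).
  move=> t0; rewrite gauss_bonnet//; last by move=> j; exact: expR_gt0.
  have := is_derive1_comp (is_derive_expR (u t i)) (ud t i t0).
  by rewrite opprB mulrC.
exists r; split.
- by apply/funext => i; rewrite /r u0 lnK ?posrE.
- by move=> t i _; exact: expR_gt0.
- by move=> i; apply: cvg_at_right_filter; apply: is_derive_continuous (rd 0 i (lexx _)).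
- by move=> t i t0; apply: rd; exact: ltW.
Qed.

End LogLipschitz.

(** * Long-time behaviour of the flow *)

Section Degenerating.
Local Open Scope classical_set_scope.
Variables (R : realType) (T : cell_division) (Phi : edge T -> R).
Hypothesis Phi_range : forall e, 0 <= Phi e <= pi / 2.
Implicit Types (x y : flag T) (i j : vertex T) (I : {set vertex T}).

(** The combinatorial condition of the theorem. *)
Definition admissible :=
  forall I : {set vertex T}, I != finset.set0 -> I != finset.setT ->
  limit_curvature Phi I < mean_curvature R T * #|I|%:R.

(** One threshold d serves all the edges, as there are finitely many. *)
Lemma inner_angle_degenerates (eps : R) : 0 < eps ->
  exists2 d, 0 < d & forall (r : vertex T -> R) x, (forall i, 0 < r i) ->
    (r (vtx x) <= d * r (vtx (opp x)) -> r (vtx x) <= d * r (vtx (opp (opp x))) ->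
       pi - Phi (edg (opp x)) - eps <= inner_angle Phi r x) /\
    (r (vtx (opp x)) <= d * r (vtx x) -> r (vtx (opp (opp x))) <= d * r (vtx x) ->
       inner_angle Phi r x <= eps).
Proof.
move=> eps0.
have [d1 d10 H1] := packed_angle_edge_shrinks eps0.
have [||d2 d20 H2] := @finite_pos_bound R (edge T) (fun e d => forall x y z g b : R,
    0 < x -> 0 < y -> 0 < z -> 0 <= g <= 1 -> 0 <= b <= 1 -> x <= d * y -> x <= d * z ->
    pi - Phi e - eps <= packed_angle x y z g (cos (Phi e)) b).
- by move=> e; apply: packed_angle_vertex_shrinks.
- move=> e d d' dd' H x y z g b x0 y0 z0 g01 b01 xy xz; apply: H => //.
    by apply: le_trans xy _; rewrite ler_wpM2r// ltW.
  by apply: le_trans xz _; rewrite ler_wpM2r// ltW.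
exists (Num.min d1 d2); first by rewrite lt_min d10.
have le1 (a b : R) : 0 < b -> a <= Num.min d1 d2 * b -> a <= d1 * b.
  by move=> b0 /le_trans; apply; rewrite ler_wpM2r ?ge_min ?lexx// ltW.
have le2 (a b : R) : 0 < b -> a <= Num.min d1 d2 * b -> a <= d2 * b.
  by move=> b0 /le_trans; apply; rewrite ler_wpM2r ?ge_min ?lexx ?orbT// ltW.
move=> r x r0; rewrite inner_angleE//; split=> h1 h2.
  by apply: H2; rewrite ?flag_cos01 ?le2.
by apply: H1; rewrite ?flag_cos01 ?le1.
Qed.

(** The gap of a triangle with one or two corners in I is small by
[packed_angle_vertex_shrinks] and [packed_angle_edge_shrinks]; the others have gap 0. *)
Lemma angle_gap_le (eps d : R) (r : vertex T -> R) I : 0 < eps ->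
  (forall i, 0 < r i) ->
  (forall x, 
    (r (vtx x) <= d * r (vtx (opp x)) -> r (vtx x) <= d * r (vtx (opp (opp x))) ->
       pi - Phi (edg (opp x)) - eps <= inner_angle Phi r x) /\
    (r (vtx (opp x)) <= d * r (vtx x) -> r (vtx (opp (opp x))) <= d * r (vtx x) ->
       inner_angle Phi r x <= eps)) ->
  (forall i j, i \in I -> j \notin I -> r i <= d * r j) ->
  forall x, angle_gap Phi r I x <= eps.
Proof.
move=> eps0 r0 H small x.
have [a1 b1] := H x; have [a2 b2] := H (opp x); have [a3 b3] := H (opp (opp x)).
rewrite !oppK3 in a2 b2 a3 b3.
have s12 := small (vtx x) (vtx (opp x)).
have s21 := small (vtx (opp x)) (vtx x).
have s13 := small (vtx x) (vtx (opp (opp x))).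
have s31 := small (vtx (opp (opp x))) (vtx x).
have s23 := small (vtx (opp x)) (vtx (opp (opp x))).
have s32 := small (vtx (opp (opp x))) (vtx (opp x)).
have S := inner_angle_sum Phi_range x r0.
rewrite /angle_gap /flag_gap /only_corner !oppK3.
move: s12 s21 s13 s31 s23 s32.
case: (vtx x \in I); case: (vtx (opp x) \in I);
  case: (vtx (opp (opp x)) \in I) => /= s12 s21 s13 s31 s23 s32.
- lra.
- have := b3 (s13 isT isT) (s23 isT isT); lra.
- have := b2 (s32 isT isT) (s12 isT isT); lra.
- have := a1 (s12 isT isT) (s13 isT isT); lra.
- have := b1 (s21 isT isT) (s31 isT isT); lra.
- have := a2 (s23 isT isT) (s21 isT isT); lra.
- have := a3 (s31 isT isT) (s32 isT isT); lra.
- lra.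
Qed.

(** For radii in I small enough compared to the others, the sum of the curvatures over I is
so close to [limit_curvature] that the strict inequality of the condition persists. *)
Lemma curvature_degenerating : admissible ->
  exists2 G : R, 0 < G & forall (r : vertex T -> R) I, (forall i, 0 < r i) ->
    I != finset.set0 -> I != finset.setT ->
    (forall i j, i \in I -> j \notin I -> ln (r i) + G <= ln (r j)) ->
    \sum_(i in I) curvature Phi r i < mean_curvature R T * #|I|%:R.
Proof.
move=> adm.
have [||eta eta0 etaP] := @finite_pos_bound R {set vertex T} (fun I e =>
   I != finset.set0 -> I != finset.setT -> limit_curvature Phi I + e <= mean_curvature R T * #|I|%:R).
- move=> I; have [I0|] := eqVneq I finset.set0; first by exists 1.
  move=> I0; have [IT|IT] := eqVneq I finset.setT; first by exists 1.
  exists (mean_curvature R T * #|I|%:R - limit_curvature Phi I) => [|_ _].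
    by rewrite subr_gt0 adm.
  by rewrite addrC subrK.
- by move=> I e e' ee' H I0 IT; apply: le_trans (H I0 IT); rewrite lerD2l.
have n0 : 0 < #|flag T|%:R :> R by rewrite ltr0n flag_nonempty.
have eps0 : 0 < eta / #|flag T|%:R by rewrite divr_gt0.
have [d d0 dP] := inner_angle_degenerates eps0.
(* a gap of G in logarithms is a ratio exp(- G), which is at most d *)
exists (`|ln d| + 1); first by rewrite ltr_pwDr.
move=> r I r0 I0 IT gap.
have small i j : i \in I -> j \notin I -> r i <= d * r j.
  move=> iI jI; rewrite -ler_ln ?posrE ?mulr_gt0// lnM ?posrE//.
  have := gap i j iI jI; have := ler_norm (- ln d); rewrite normrN; lra.
have gapP := angle_gap_le eps0 r0 (fun x => dP r x r0) small.
rewrite curvature_sub//; apply: lt_le_trans (etaP I I0 IT); rewrite ltrD2l.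
apply: (@le_lt_trans _ _ (eta / 6)); last by lra.
rewrite ler_wpM2r//; apply: le_trans (ler_sum _ (fun x _ => gapP x)) _.
by rewrite sumr_const -[leLHS]mulr_natr mulfVK ?gt_eqF.
Qed.

End Degenerating.

Section Flow.
Local Open Scope classical_set_scope.
Variables (R : realType) (T : cell_division) (Phi : edge T -> R).
Hypothesis Phi_range : forall e, 0 <= Phi e <= pi / 2.
Variables (r0 : vertex T -> R) (r : R -> vertex T -> R).
Hypothesis flow : ricci_flow Phi r0 r.
Implicit Types (x y : flag T) (i j : vertex T) (I J : {set vertex T}) (t s : R).

Let excess t i : R := curvature Phi (r t) i - mean_curvature R T.

Lemma flow_gt0 t i : 0 <= t -> 0 < r t i.
Proof. by case: flow => _ + _ _; apply. Qed.

Lemma flow_right_continuous i : r t i @[t --> 0^'+] --> r 0 i.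
Proof. by case: flow. Qed.

Lemma flow_deriv t i : 0 < t -> is_derive t 1 (r^~ i) (r t i * - excess t i).
Proof.
move=> t0; case: flow => _ _ _ /(_ t i t0).
rewrite gauss_bonnet//; first by rewrite mulrC.
by move=> j; apply: flow_gt0; exact: ltW.
Qed.

Lemma flow_deriv_ln t i : 0 < t -> is_derive t 1 (fun s => ln (r s i)) (- excess t i).
Proof.
move=> t0; have rt := flow_gt0 i (ltW t0).
have H := is_derive1_comp (is_derive1_ln rt) (flow_deriv i t0).
apply: (is_derive_eq H).
by rewrite mulrA mulVf ?mul1r// gt_eqF.
Qed.

Lemma ln_right_continuous i : ln (r t i) @[t --> 0^'+] --> ln (r 0 i).
Proof.
apply: (continuous_cvg _ (continuous_ln (flow_gt0 i (lexx 0)))).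
exact: flow_right_continuous.
Qed.

Lemma excess_sum t : 0 <= t -> \sum_i excess t i = 0.
Proof.
move=> t0; have H := gauss_bonnet Phi_range (fun i => flow_gt0 i t0).
rewrite /excess sumrB -H /curvature_avg sumr_const -[X in _ - X]mulr_natr mulfVK ?subrr//.
by rewrite pnatr_eq0 -lt0n vertices_gt0.
Qed.

Section Necessity.
Variables Koo roo : vertex T -> R.
Hypothesis conv : converges_to Phi r Koo roo.

Lemma limit_radius_gt0 i : 0 < roo i. Proof. by case: (conv i). Qed.

(** The derivative of r_i tends to a multiple of the limit of the excess; since r_i
converges, that limit is 0. *)
Lemma curvature_limit_eq i : Koo i = mean_curvature R T.
Proof.
have [_ ro0 Kcv rcv] := conv i.
have H : r t i * - excess t i @[t --> +oo] --> roo i * - (Koo i - mean_curvature R T).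
  apply: cvgM => //; apply: cvgN; apply: cvgB => //; exact: cvg_cst.
have := deriv_limit_eq0 (fun t h => flow_deriv i h) rcv H.
by move=> /eqP; rewrite mulf_eq0 gt_eqF//= oppr_eq0 subr_eq0 => /eqP.
Qed.

Lemma curvature_limit_radius i : curvature Phi roo i = mean_curvature R T.
Proof.
rewrite -(curvature_limit_eq i); have [_ _ Kcv _] := conv i.
have K : curvature Phi (r t) i @[t --> +oo] --> curvature Phi roo i.
  apply: (@curvature_cvg R T Phi Phi_range R (pinfty_nbhs R) r roo i _).
  - near=> t => j; apply: flow_gt0; near: t; apply: nbhs_pinfty_ge; exact: num_real.
  - by move=> j; exact: limit_radius_gt0.
  - by move=> j; case: (conv j).
exact: (cvg_unique _ K Kcv).
Unshelve. all: by end_near.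
Qed.

Lemma convergent_admissible : admissible Phi.
Proof.
move=> I I0 IT; have := limit_curvature_lt Phi_range limit_radius_gt0 I0 IT.
under eq_bigr do rewrite curvature_limit_radius.
by rewrite sumr_const mulr_natr.
Qed.

End Necessity.

Section Bounded.
Hypothesis adm : admissible Phi.

(** The maximum of the finitely many functions phi_I does not increase.  If it exceeded all
initial values, it would be attained on [0, t1] by some phi_J at some u > 0 with J
proper and nonempty, since phi is constant for the empty and for the full set.
Comparing J with J minus a vertex and with J plus a vertex, the concavity of c shows that
the logarithms of the radii in J lie at least G below the others, so phi_J is strictly
decreasing at u: a contradiction. *)
Lemma flow_log_bounded : exists B : R, forall t i, 0 <= t -> `|ln (r t i)| <= B.
Proof.
have [G G0 GP] := curvature_degenerating Phi_range adm.
pose N : R := #|vertex T|%:R.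
pose c (k : nat) : R := G / 2 * k%:R * (N - k%:R).
pose phi I t := - (\sum_(i in I) ln (r t i)) - c #|I|.
pose V := \sum_I `|phi I 0|.
have phiV I : phi I 0 <= V.
  apply: le_trans (ler_norm _) _; rewrite /V (bigD1 I)//= lerDl sumr_ge0//.
have phid I t : 0 < t -> is_derive t 1 (phi I) (\sum_(i in I) excess t i).
  move=> t0.
  have H := @is_derive_bigsum R _ (index_enum (vertex T)) (fun i => i \in I) _ _ t
    (fun i => flow_deriv_ln i t0).
  have -> : phi I = - (fun s => \sum_(i in I) ln (r s i)) - cst (c #|I|) by [].
  by apply: is_derive_eq; rewrite sumrN opprK subr0.
have phi0 I : phi I t @[t --> 0^'+] --> phi I 0.
  apply: cvgB; last exact: cvg_cst.
  by apply: cvgN; apply: cvg_bigsum => i; exact: ln_right_continuous.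
have phiT t : 0 <= t -> phi finset.setT t <= V.
  move=> t0; apply: le_trans (phiV finset.setT).
  apply: (right_deriv_le0 (df := fun s => \sum_(i in finset.setT) excess s i) t0 (phi0 _)).
    by move=> s /andP[s0 _]; exact: phid.
  move=> s /andP[s0 _] /=; rewrite (eq_bigl xpredT); last by move=> i; rewrite finset.in_setT.
  by rewrite excess_sum// ltW.
have phi_0 t : phi finset.set0 t <= V.
  by rewrite /phi big_set0 cards0 /c mulr0 mul0r oppr0 addr0 sumr_ge0.
have phi_le I1 t1 : 0 <= t1 -> phi I1 t1 <= V.
  rewrite le_eqVlt => /predU1P[<-|t10]; first exact: phiV.
  rewrite leNgt; apply/negP => Vlt.
  have Hmax J : exists s : R, 0 <= s <= t1 /\ forall u, 0 <= u <= t1 -> phi J u <= phi J s.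
    have [|s + H] := @EVT_max R (phi J) 0 t1 (ltW t10).
      apply/continuous_within_itvP => //; split=> //.
        move=> u; rewrite in_itv/= => /andP[u0 _].
        exact: is_derive_continuous (phid J u u0).
      by apply: cvg_at_left_filter; exact: is_derive_continuous (phid J t1 t10).
    by rewrite in_itv/= => s01; exists s.
  have [s sP] := choice Hmax.
  case: (arg_maxP (fun J => phi J (s J)) (isT : xpredT I1)) => J _ Jmax.
  have [/andP[s0 st1] smax] := sP J; set u := s J in s0 st1 smax Jmax.
  have umax K : phi K u <= phi J u.
    apply: le_trans (Jmax K isT); have [_] := sP K; apply.
    by rewrite s0.
  have uV : V < phi J u.
    apply: lt_le_trans Vlt _; apply: le_trans (Jmax I1 isT).
    by have [_] := sP I1; apply; rewrite lexx (ltW t10).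
  have u0 : 0 < u.
    rewrite lt_neqAle s0 andbT; apply/eqP => E.
    by move: uV; rewrite -E ltNge phiV.
  have J0 : J != finset.set0 by apply/eqP => E; move: uV; rewrite E ltNge phi_0.
  have JT : J != finset.setT by apply/eqP => E; move: uV; rewrite E ltNge phiT.
  have gap i j : i \in J -> j \notin J -> ln (r u i) + G <= ln (r u j).
    move=> iJ jJ.
    have := umax (J :\ i); have := umax (j |: J).
    rewrite /phi (big_setU1 _ jJ)/= (big_setD1 i iJ)/= cardsU1 jJ (cardsD1 i J) iJ /c.
    rewrite !natrD /=; set k := (#|J :\ i|)%:R; move=> h1 h2; lra.
  have : 0 <= \sum_(i in J) excess u i.
    apply: (deriv_ge0_at_left_max (a := 0) (b := t1) (t := u) (f := phi J)); first by rewrite u0.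
      exact: phid.
    by move=> v; exact: smax.
  apply/negP; rewrite -ltNge /excess sumrB sumr_const subr_lt0.
  have := GP (r u) J (fun i => flow_gt0 i s0) J0 JT gap.
  by rewrite mulr_natr.
pose S := \sum_i ln (r 0 i).
have sumT t : 0 <= t -> \sum_i ln (r t i) = S.
  move=> t0.
  have cv : \sum_i ln (r t i) @[t --> 0^'+] --> S.
    by apply: cvg_bigsum => i; exact: ln_right_continuous.
  have dv (s : R) : 0 < s -> is_derive s 1 (fun t => \sum_i ln (r t i)) 0.
    move=> s0; have := @is_derive_bigsum R _ (index_enum (vertex T)) xpredT _ _ s
      (fun i => flow_deriv_ln i s0).
    by rewrite sumrN excess_sum ?oppr0// ltW.
  apply/eqP; rewrite eq_le; apply/andP; split.
    by apply: (right_deriv_le0 (df := cst 0) t0 cv) => [s /andP[s0 _]|//]; exact: dv.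
  rewrite -lerN2.
  apply: (right_deriv_le0 (f := fun t => - \sum_i ln (r t i)) (df := cst 0) t0).
  - exact: cvgN.
  - move=> s /andP[s0 _]; have H := dv s s0.
    by apply: (is_derive_eq (is_deriveN H)); rewrite oppr0.
  - by [].
exists (V + `|c 1| + `|c #|vertex T|.-1| + `|S|) => t i t0.
have := phi_le [set i]%SET t t0; have := phi_le (~: [set i])%SET t t0.
have -> : phi (~: [set i])%SET t = ln (r t i) - S - c #|vertex T|.-1.
  rewrite /phi cardsC1 -(sumT t t0) [in RHS](bigD1 i)//=.
  rewrite (eq_bigl (fun j => j != i)); last by move=> j; rewrite !inE.
  by ring.
rewrite /phi big_set1 cards1.
have := ler_norm (c 1); have := ler_norm (c #|vertex T|.-1); have := ler_norm S.
have := ler_norm (- S); rewrite normrN.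
have := normr_ge0 (c 1); have := normr_ge0 (c #|vertex T|.-1).
have := normr_ge0 S.
move=> h1 h2 h3 h4 h5 h6 h7 h8 h9.
by rewrite ler_norml; apply/andP; split; lra.
Qed.

Lemma flow_bounded : exists m M : R, 0 < m /\ forall t i, 0 <= t -> m <= r t i <= M.
Proof.
have [B HB] := flow_log_bounded.
exists (expR (- B)), (expR B); split; first exact: expR_gt0.
move=> t i t0; have := HB t i t0; rewrite ler_norml => /andP[h1 h2].
have -> : r t i = expR (ln (r t i)) by rewrite lnK ?posrE ?flow_gt0.
by rewrite !ler_expR h1.
Qed.

Lemma excess_bounded : exists B : R, 0 <= B /\ forall t i, 0 <= t -> `|excess t i| <= B.
Proof.
exists (2 * pi + #|flag T|%:R * pi + `|mean_curvature R T|); split.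
  by rewrite !addr_ge0// mulr_ge0// pi_ge0.
move=> t i t0; apply: le_trans (ler_normB _ _) _; rewrite lerD2r.
apply: le_trans (ler_normB _ _) _; apply: lerD.
  by rewrite ger0_norm// mulr_ge0// pi_ge0.
have gt0 x : 0 < inner_angle Phi (r t) x.
  by apply: inner_angle_gt0 => // j; exact: flow_gt0.
have s0 : 0 <= \sum_(x | vtx x == i) inner_angle Phi (r t) x.
  by apply: sumr_ge0 => x _; exact: ltW.
rewrite ger0_norm ?divr_ge0// ler_pdivrMr//.
apply: (@le_trans _ _ (\sum_(x : flag T) pi)).
  rewrite big_mkcond/=; apply: ler_sum => x _; case: ifP => _; last exact: pi_ge0.
  have := inner_angle_sum Phi_range x (fun j => flow_gt0 j t0).
  have := gt0 x; have := gt0 (opp x); have := gt0 (opp (opp x)); lra.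
rewrite sumr_const -mulr_natl; have : 0 <= #|flag T|%:R * pi :> R by rewrite mulr_ge0// pi_ge0.
lra.
Qed.

(** Summation by parts: the weights of the two ends of an edge agree. *)
Lemma energy_deriv t : 0 < t -> is_derive t 1 (fun s => \sum_i excess s i ^+ 2)
  (- \sum_x flag_weight Phi (r t) x * (excess t (vtx x) - excess t (vtx (opp x))) ^+ 2).
Proof.
move=> t0; pose w := flag_weight Phi (r t); pose g x := excess t (vtx x).
pose A x := w x * (g x - g (opp x)) + w (opp (opp x)) * (g x - g (opp (opp x))).
have fd i : is_derive t 1 (excess^~ i) (- (\sum_(x | vtx x == i) A x) / 2).
  have K := is_derive_curvature Phi_range i (fun j => flow_gt0 j (ltW t0))
    (fun j => flow_deriv j t0).
  have -> : excess^~ i = (fun s => curvature Phi (r s) i) - cst (mean_curvature R T) by [].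
  apply: is_derive_eq; rewrite subr0; congr (- _ / 2).
  by apply: eq_bigr => x _; rewrite /A /w /g; ring.
have sd i : is_derive t 1 (fun s => excess s i ^+ 2)
    (- (excess t i * \sum_(x | vtx x == i) A x)).
  have -> : (fun s => excess s i ^+ 2) = excess^~ i * excess^~ i by apply/funext => s; rewrite expr2.
  have fdi := fd i; apply: is_derive_eq; rewrite /GRing.scale/=; by field.
apply: (is_derive_eq (is_derive_bigsum _ _ sd)).
have -> : \sum_x w x * (g x - g (opp x)) ^+ 2 = \sum_x g x * A x.
  under [RHS]eq_bigr do rewrite /A mulrDr.
  rewrite big_split/= -[X in _ + X]sum_opp -big_split/=.
  by apply: eq_bigr => x _; rewrite !oppK3; ring.
rewrite -(sum_vertex_flags xpredT) -sumrN; apply: eq_bigr => i _.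
by rewrite mulr_sumr; congr (- _); apply: eq_bigr => x /eqP xi; rewrite /g xi.
Qed.

(** Of the three factors 1 - g + a + b, 1 - a + b + g, 1 - b + g + a of a triangle any two
add up to at least 2, so at most one is small; the differences of the excess along the
three sides add up to 0, so the two other sides control the third one.  Then [poincare]
applies. *)
Lemma energy_dissipation (m M : R) : 0 < m ->
  (forall t i, 0 <= t -> m <= r t i <= M) ->
  exists2 lam : R, 0 < lam & forall t, 0 <= t ->
   2 * lam * \sum_i excess t i ^+ 2 <=
   \sum_x flag_weight Phi (r t) x * (excess t (vtx x) - excess t (vtx (opp x))) ^+ 2.
Proof.
move=> m0 rb; have [C C0 HC] := poincare R T.
have M0 : 0 < M.
  have /card_gt0P[x _] := flag_nonempty T.
  by have /andP[h1 h2] := rb 0 (vtx x) (lexx 0); apply: lt_le_trans m0 (le_trans h1 h2).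
pose k := m ^+ 4 / (16 * M ^+ 4).
have k0 : 0 < k by rewrite /k divr_gt0 ?exprn_gt0// mulr_gt0 ?exprn_gt0.
exists (k / (12 * C)); first by rewrite divr_gt0// mulr_gt0.
move=> t t0; have H := HC (excess t) (excess_sum t0).
pose d x := excess t (vtx x) - excess t (vtx (opp x)).
rewrite -/(d _) in H *.
have dsum x : d x + d (opp x) + d (opp (opp x)) = 0 by rewrite /d !oppK3; ring.
have wge x : k * (1 - flag_cos Phi x + flag_cos Phi (opp x) + flag_cos Phi (opp (opp x)))
    <= flag_weight Phi (r t) x.
  by apply: weight_ge; rewrite ?flag_cos01 ?rb ?flow_gt0.
apply: (@le_trans _ _ (k / 6 * \sum_x d x ^+ 2)).
  apply: le_trans (ler_wpM2l _ H) _; first by rewrite mulr_ge0// ltW// divr_gt0// mulr_gt0.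
  by rewrite le_eqVlt; apply/orP; left; apply/eqP; field; rewrite gt_eqF.
rewrite [leRHS]sum_triangle_average.
have -> : k / 6 * \sum_x d x ^+ 2 = (\sum_x k / 2 * d x ^+ 2) / 3.
  by rewrite -mulr_sumr; field.
rewrite ler_wpM2r//; apply: ler_sum => x _.
set W1 := flag_weight _ _ x; set W2 := flag_weight _ _ (opp x).
set W3 := flag_weight _ _ (opp (opp x)).
have w1 := wge x; have w2 := wge (opp x); have w3 := wge (opp (opp x)).
rewrite !oppK3 -/W1 -/W2 -/W3 in w1 w2 w3.
move: (dsum x) (flag_cos01 Phi_range x) (flag_cos01 Phi_range (opp x)) (flag_cos01 Phi_range (opp (opp x))).
move: w1 w2 w3; set g := flag_cos Phi x; set a := flag_cos Phi (opp x).
set b := flag_cos Phi (opp (opp x)) => w1 w2 w3 ds /andP[g0 g1] /andP[a0 a1] /andP[b0 b1].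
have d2 y : 0 <= d y ^+ 2 by exact: sqr_ge0.
apply: le_trans (lerD (lerD (ler_wpM2r (d2 _) w1) (ler_wpM2r (d2 _) w2)) (ler_wpM2r (d2 _) w3)).
have -> : k / 2 * d x ^+ 2 = k * (2^-1 * d x ^+ 2) by field.
rewrite [leRHS](_ : _ = k * ((1 - g + a + b) * d x ^+ 2
  + (1 - a + b + g) * d (opp x) ^+ 2 + (1 - b + g + a) * d (opp (opp x)) ^+ 2)); last by ring.
rewrite ler_pM2l//.
have E3 : d x ^+ 2 = (d (opp x) + d (opp (opp x))) ^+ 2.
  have -> : d (opp x) + d (opp (opp x)) = - d x by lra.
  by rewrite sqrrN.
have E4 : d x ^+ 2 <= 2 * (d (opp x) ^+ 2 + d (opp (opp x)) ^+ 2).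
  by rewrite E3; have := sqr_ge0 (d (opp x) - d (opp (opp x))); rewrite !expr2; lra.
have p1 : 0 <= 1 - g + a + b by lra.
have p2 : 0 <= 1 - a + b + g by lra.
have p3 : 0 <= 1 - b + g + a by lra.
have q1 := mulr_ge0 p1 (d2 x); have q2 := mulr_ge0 p2 (d2 (opp x)).
have q3 := mulr_ge0 p3 (d2 (opp (opp x))).
have [p|p] := leP (2^-1) (1 - g + a + b).
  by have := ler_wpM2r (d2 x) p; lra.
have p2' : 1 <= 1 - a + b + g by lra.
have p3' : 1 <= 1 - b + g + a by lra.
have := ler_wpM2r (d2 (opp x)) p2'; have := ler_wpM2r (d2 (opp (opp x))) p3'.
lra.
Qed.

(** Gronwall for the sum of the squares; the times before 1 are absorbed in the
constant. *)
Lemma excess_decay : exists A lam : R, [/\ 0 <= A, 0 < lam &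
  forall t i, 0 <= t -> `|excess t i| <= A * expR (- lam * t)].
Proof.
have [m [M [m0 rb]]] := flow_bounded.
have [lam lam0 dis] := energy_dissipation m0 rb.
have [B [B0 fB]] := excess_bounded.
pose E t := \sum_i excess t i ^+ 2.
pose E0 := #|vertex T|%:R * B ^+ 2.
have E00 : 0 <= E0 by rewrite mulr_ge0// exprn_ge0.
have EE0 t : 0 <= t -> E t <= E0.
  move=> t0; apply: (@le_trans _ _ (\sum_(i : vertex T) B ^+ 2)); last first.
    by rewrite sumr_const -[leLHS]mulr_natl.
  apply: ler_sum => i _; rewrite -[leLHS]real_normK ?num_real//.
  by rewrite ler_pXn2r ?nnegrE// fB.
have Edecay t : 0 <= t -> E t <= E0 * expR (2 * lam) * expR (- (2 * lam) * t).
  move=> t0; rewrite mulNr expRN ler_pdivlMr ?expR_gt0//.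
  have [t1|/ltW t1] := leP t 1.
    rewrite ler_pM ?expR_ge0 ?EE0 ?ler_expR//; first by apply: sumr_ge0 => i _; exact: sqr_ge0.
    by rewrite ler_piMr// mulr_ge0// ltW.
  apply: (@le_trans _ _ (E 1 * expR (2 * lam * 1))); last first.
    by rewrite mulr1 ler_wpM2r ?expR_ge0// EE0.
  pose dE s := - \sum_x flag_weight Phi (r s) x * (excess s (vtx x) - excess s (vtx (opp x))) ^+ 2.
  apply: (@deriv_le0 R (E * (fun s => expR (2 * lam * s)))
    (fun s => E s *: (2 * lam * expR (2 * lam * s)) + expR (2 * lam * s) *: dE s)) => //.
    move=> s /andP[s1 _]; have s0 : 0 < s by apply: lt_le_trans s1.
    have Es := energy_deriv s0; have es := is_derive_expRM (2 * lam) s.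
    exact: is_deriveM.
  move=> s /andP[s1 _]; have s0 : 0 <= s by apply: le_trans s1.
  rewrite /GRing.scale/=.
  have -> : E s * (2 * lam * expR (2 * lam * s)) + expR (2 * lam * s) * dE s =
    expR (2 * lam * s) * (2 * lam * E s + dE s) by ring.
  by rewrite mulr_ge0_le0 ?expR_ge0// /dE subr_le0 dis.
exists (Num.sqrt (E0 * expR (2 * lam))), lam; split => //.
move=> t i t0; rewrite -(@ler_pXn2r _ 2)// ?nnegrE ?mulr_ge0 ?sqrtr_ge0 ?expR_ge0//.
rewrite real_normK ?num_real// exprMn sqr_sqrtr ?mulr_ge0 ?expR_ge0//.
have -> : expR (- lam * t) ^+ 2 = expR (- (2 * lam) * t).
  by rewrite expr2 -expRD; congr expR; ring.
apply: le_trans (Edecay t t0).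
by rewrite /E (bigD1 i)//= lerDl sumr_ge0// => j _; exact: sqr_ge0.
Qed.

Lemma mean_curvature_lt2pi : mean_curvature R T < 2 * pi.
Proof.
have N0 : 0 < #|vertex T|%:R :> R by rewrite ltr0n vertices_gt0.
rewrite /mean_curvature ltr_pdivrMr// ltr_pM2l ?mulr_gt0 ?pi_gt0// euler_flags.
by rewrite gtrDl oppr_lt0 divr_gt0// ltr0n flag_nonempty.
Qed.

Lemma admissible_convergent : exists roo,
  converges_to Phi r (fun=> mean_curvature R T) roo /\
  exponentially_fast Phi r (fun=> mean_curvature R T) roo.
Proof.
have [A [lam [A0 lam0 fA]]] := excess_decay.
have [m [M [m0 rb]]] := flow_bounded.
have M0 : 0 <= M.
  have /card_gt0P[x _] := flag_nonempty T.
  have /andP[h1 h2] := rb 0 (vtx x) (lexx 0).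
  exact: le_trans (ltW m0) (le_trans h1 h2).
have AM0 : 0 <= M * A / lam by rewrite divr_ge0 ?mulr_ge0// ltW.
have H i : exists l, forall t, 0 <= t -> `|r t i - l| <= M * A / lam * expR (- lam * t).
  apply: (@exponential_limit R (r^~ i) (fun t => r t i * - excess t i) _ _ lam0 AM0).
  - exact: flow_right_continuous.
  - by move=> t t0; exact: flow_deriv.
  move=> t t0; rewrite mulfVK ?gt_eqF// normrM normrN -mulrA; apply: ler_pM => //.
    have /andP[h1 h2] := rb t i (ltW t0).
    by rewrite ger0_norm// (le_trans _ h1)// ltW.
  exact: fA (ltW t0).
have [roo rooP] := choice H.
have rcv i : r t i @[t --> +oo] --> roo i := exponential_cvg lam0 (rooP i).
exists roo; split.
  move=> i; split => //; first exact: mean_curvature_lt2pi.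
    apply: lt_le_trans m0 _; rewrite -(cvg_lim _ (rcv i))//.
    apply: limr_ge; first by apply: cvgP (rcv i).
    near=> t; have t0 : 0 <= t by near: t; apply: nbhs_pinfty_ge; exact: num_real.
    by have /andP[] := rb t i t0.
  exact: (exponential_cvg lam0 (fun t h => fA t i h)).
exists (A + M * A / lam + 1), lam; split => //; first by rewrite ltr_wpDl// addr_ge0.
move=> t i t0; split.
  apply: le_trans (fA t i t0) _; rewrite ler_wpM2r ?expR_ge0//.
  by rewrite -addrA lerDl addr_ge0.
apply: le_trans (rooP i t t0) _; rewrite ler_wpM2r ?expR_ge0//.
by rewrite addrAC lerDr addr_ge0.
Unshelve. all: by end_near.
Qed.

End Bounded.

End Flow.

Theorem theorem6p1 (R : realType) (T : cell_division) (Phi : edge T -> R)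
    (r0 : vertex T -> R)
    (T_triangulation : generalized_triangulation T)
    (Phi_range : forall e, 0 <= Phi e <= pi / 2)
    (r0_gt0 : forall i, 0 < r0 i) :
  (exists r, ricci_flow Phi r0 r) /\
  forall r, ricci_flow Phi r0 r ->
    (convergent Phi r <->
     forall I : {set vertex T}, I != finset.set0 -> I != finset.setT ->
       2 * pi * (euler T)%:~R * #|I|%:R / #|vertex T|%:R >
       - (\sum_(p in Lk I) (pi - Phi p.1.1)) + 2 * pi * (euler_sub I)%:~R) /\
    (forall Koo roo, converges_to Phi r Koo roo ->
       exponentially_fast Phi r Koo roo /\
       forall i, Koo i = 2 * pi * (euler T)%:~R / #|vertex T|%:R).
Proof.
split; first exact: ricci_flow_exists.
move=> r flow.
have admE : admissible Phi <-> forall I : {set vertex T},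
    I != finset.set0 -> I != finset.setT ->
    2 * pi * (euler T)%:~R * #|I|%:R / #|vertex T|%:R >
    - (\sum_(p in Lk I) (pi - Phi p.1.1)) + 2 * pi * (euler_sub I)%:~R.
  have kE (I : {set vertex T}) : mean_curvature R T * #|I|%:R =
      2 * pi * (euler T)%:~R * #|I|%:R / #|vertex T|%:R by rewrite /mean_curvature mulrAC.
  by split=> H I I0 IT; have := H I I0 IT; rewrite -kE.
split.
  rewrite -admE; split=> [[Koo [roo conv]]|adm].
    exact: (convergent_admissible Phi_range flow conv).
  have [roo [conv _]] := admissible_convergent Phi_range flow adm.
  by exists (fun=> mean_curvature R T), roo.
move=> Koo roo conv.
have KooE := curvature_limit_eq Phi_range flow conv.
have [roo' [conv' fast]] := admissible_convergent Phi_range flow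
  (convergent_admissible Phi_range flow conv).
split => //.
have -> : Koo = fun=> mean_curvature R T by apply/funext.
have -> // : roo = roo'.
apply/funext => i; have [_ _ _ h] := conv i; have [_ _ _ h'] := conv' i.
exact: (cvg_unique _ h h').
Qed.
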